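(* Let $\mathbf R:V\cup V^*\to\mathbb R^3$ be a closed discrete ellipsoid together with its dual, as defined in the context. Then: (i) The umbilic vertices and umbilic edges constitute degenerations of the discrete circular cross sections. (ii) The planes $\Box(n_1,n_2)$ along any discrete circular cross section intersect in a point which lies on one of the two lines passing through opposite umbilic vertices.
   Context: Let $N_1,N_2$ be positive integers, $\delta=\frac{\pi}{2N_1+2N_2-1}$, and let $a>b>c>0$ satisfy $$\frac{a-2b+c}{a-c}=\frac{\cos\frac{(4N_2-1)\pi}{4N_1+4N_2-2}}{\cos\frac{\pi}{4N_1+4N_2-2}} .$$ Let $\hat f_3,\hat h_3>0$ be constants with $(b-c)\hat f_3^2+(a-b)\hat h_3^2=a-c$. Put $$U=\{(n_1,n_2)\in\mathbb Z^2:|n_i|\le N_i\},\qquad U^*=\{(n_1,n_2)\in(\mathbb Z+\tfrac12)^2:|n_i|\le N_i-\tfrac12\},$$ $f_1(n)=\sqrt{\frac{a-c}{\cos(\delta/2)}}\sin(\delta n)$, $h_1(n)=\sqrt{\frac{a-c}{\cos(\delta/2)}}\cos(\delta n)$, $f_2(n)=\sqrt{\frac{a-c}{\cos(\delta/2)}}\cos(\delta n)$, $h_2(n)=\sqrt{\frac{a-c}{\cos(\delta/2)}}\sin(\delta n)$. The real functions $g_i$ on $\{n\in\frac12\mathbb Z:|n|\le N_i\}$ are determined by their values at $0$ and the recurrence relations $$g_1(n+\tfrac12)=\frac{a-b-f_1(n)f_1(n+\tfrac12)}{g_1(n)},\qquad g_2(n+\tfrac12)=\frac{f_2(n)f_2(n+\tfrac12)-a+b}{g_2(n)}$$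 (equivalently, with the denominators multiplied out); by the choice of $\delta$ and $a,b,c$ they satisfy the boundary conditions $g_1(\pm N_1)=0$, $g_2(\pm N_2)=0$. Fix nonzero $g_1^0,g_2^0$. The discrete semi-ellipsoids $\mathbf r^{\pm}:U\cup U^*\to\mathbb R^3$ are $$\mathbf r=\left(\tfrac{f_1(n_1)f_2(n_2)\hat f_3}{\sqrt{(a-b)(a-c)}},\ \tfrac{g_1(n_1)g_2(n_2)}{\sqrt{(a-b)(b-c)}},\ \tfrac{h_1(n_1)h_2(n_2)\hat h_3}{\sqrt{(a-c)(b-c)}}\right)$$ with initial values $g_1(0)=\pm g_1^0$, $g_2(0)=g_2^0$; thus $\mathbf r^-$ is the mirror image of $\mathbf r^+$ in the plane $y=0$. Let $$V=\{(n_1,n_2)\in\mathbb Z^2:-N_1\le n_1\le 3N_1,\,|n_2|\le N_2\},\quad V^*=\{(n_1,n_2)\in(\mathbb Z+\tfrac12)^2:-N_1<n_1<3N_1,\,|n_2|<N_2\},$$ and $\mathbf R(n_1,n_2)=\mathbf r^+(n_1,n_2)$ if $n_1\le N_1$, $\mathbf R(n_1,n_2)=\mathbf r^-(2N_1-n_1,n_2)$ if $n_1\ge N_1$. Gluing: $\mathbf r^+(U)$ and $\mathbf r^-(U)$ are glued along the corresponding edges of their boundaries (where $\mathbf r^+=\mathbf r^-$, as $y=0$); $\mathbf r^+(U^* )$ and $\mathbf r^-(U^* )$ are glued by adding an edge joining $\mathbf r^+(p)$ and $\mathbf r^-(p)$ for each boundary point $p$ of $U^*$ (i.e. $|n_1|=N_1-\frac12$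 or $|n_2|=N_2-\frac12$). The discrete ellipsoid $\mathbf R(V)$ and its dual $\mathbf R(V^* )$ are then entirely composed of planar quadrilaterals, including the additional ones created by the gluing. $\Box(n_1,n_2)$ denotes the plane of the quadrilateral with vertices $\mathbf R(n_1\pm\frac12,n_2\pm\frac12)$ dual to the vertex $\mathbf R(n_1,n_2)$ (at boundary vertices of $U$, of the corresponding additional quadrilateral). Umbilic vertices: the four vertices $\mathbf r^{\pm}(\sigma_1N_1,\sigma_2N_2)$, $\sigma_1,\sigma_2\in\{1,-1\}$ (here $\mathbf r^+=\mathbf r^-$), which have valence 2 in $\mathbf R(V)$; the vertices for $(\sigma_1,\sigma_2)$ and $(-\sigma_1,-\sigma_2)$ are opposite. Umbilic edges: the four added edges joining $\mathbf r^+(p)$ and $\mathbf r^-(p)$ for $p=(\sigma_1(N_1-\frac12),\sigma_2(N_2-\frac12))$; their end points have valence 3 in $\mathbf R(V^* )$. Discrete circular cross sections: on each of $\mathbf r^+$ and $\mathbf r^-$, the points with $n_1+n_2=\mathrm{const}$, respectively $n_1-n_2=\mathrm{const}$, form diagonal polygons (discrete semi-circles). Corresponding polygons (same sign, same constant) of $\mathbf r^+$ and $\mathbf r^-$ are joined to closed polygons: for points of $U$ they share their boundary vertices, for points of $U^*$ they are connected by added edges. The resulting closed diagonal polygons in $V\cup V^*$ are the discrete circular cross sections; they form two finite sequences, one for each sign, and ''degenerations'' refers to the ends of these sequences, where the polygons collapse to a vertex or an edge.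
   Formalization: In (ii) the common point may lie at infinity when n1±n2=0 (no finite one exists there in general), umbilic vertices, which have no dual quadrilateral, are skipped, and the point is claimed to be the only common one only when the section carries at least three planes. *)

(* Defs.v *)
From HB Require Import structures.
From mathcomp Require Import all_boot all_order all_algebra.
From mathcomp Require Import all_classical all_reals all_analysis.

Set Implicit Arguments.
Unset Strict Implicit.
Unset Printing Implicit Defensive.

Import Order.TTheory GRing.Theory Num.Theory.
Local Open Scope ring_scope.

(* Half-integers are encoded by their doubles: the lattice point (n1, n2) of
   Z^2 or (Z + 1/2)^2 is the pair m = (2 n1, 2 n2) of integers, both even
   resp. both odd. *)
Definition idx : Type := (int * int)%type.

Definition half (R : realType) (m : int) : R := m%:~R / 2.

Definition signs : seq int := [:: 1; -1].

Definition zrange (n : nat) : seq int :=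
  [seq k%:Z - n%:Z | k <- iota 0 n.*2.+1].

(** * The index sets and their gluing *)

(* The boolean [star] selects the primal (false) or the dual (true) lattice. *)
Definition parity (star : bool) (m : idx) : bool :=
  (odd `|m.1|%N == star) && (odd `|m.2|%N == star).

Definition inU (N1 N2 : nat) (star : bool) (m : idx) : bool :=
  [&& parity star m,
      `|m.1| <= 2 * N1%:Z - star%:Z & `|m.2| <= 2 * N2%:Z - star%:Z].

Definition inV (N1 N2 : nat) (m : idx) : bool :=
  [&& parity false m, - (2 * N1%:Z) <= m.1 <= 6 * N1%:Z & `|m.2| <= 2 * N2%:Z].

Definition inVstar (N1 N2 : nat) (m : idx) : bool :=
  [&& parity true m, - (2 * N1%:Z) < m.1 < 6 * N1%:Z & `|m.2| < 2 * N2%:Z].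

(* r^-(n1, n2) = R(2 N1 - n1, n2): for an index p of U or U^*, the points
   r^+(p) and r^-(p) have the indices p and mirror p in V or V^*. *)
Definition mirror (N1 : nat) (m : idx) : idx := (4 * N1%:Z - m.1, m.2).

(* The vertex of V identified with m when the boundaries of r^+(U) and r^-(U)
   are glued; glue m = m away from these boundaries, in particular on V^*. *)
Definition glue (N1 N2 : nat) (m : idx) : idx :=
  if (m.1 \in [:: - (2 * N1%:Z); 2 * N1%:Z; 6 * N1%:Z])
     || (`|m.2| == 2 * N2%:Z)
  then mirror N1 m else m.

(* All (n1 +- 1/2, n2 +- 1/2). *)
Definition around (m : idx) : seq idx :=
  [seq (m.1 + e1, m.2 + e2) | e1 <- signs, e2 <- signs].

(* The vertices of the face dual to m: the points of the other lattice that
   are diagonal neighbours of m or of the vertex glued to m.  At a boundary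
   vertex p of U other than a corner these are the r^{+-}(q) for the two
   q in U^* next to p, i.e. the additional quadrilateral; at a corner only the
   two end points of an added edge remain. *)
Definition dual_face (N1 N2 : nat) (m : idx) : seq idx :=
  [seq w <- undup (around m ++ around (glue N1 N2 m))
     | inV N1 N2 w || inVstar N1 N2 w].

(** * Umbilics *)

Definition umbilic_vertex (N1 N2 : nat) (s1 s2 : int) : idx :=
  (s1 * (2 * N1%:Z), s2 * (2 * N2%:Z)).

Definition umbilic_vertices (N1 N2 : nat) : seq idx :=
  [seq umbilic_vertex N1 N2 s1 s2 | s1 <- signs, s2 <- signs].

(* The edge joining r^+(p) and r^-(p), p = (s1 (N1 - 1/2), s2 (N2 - 1/2)). *)
Definition umbilic_edge (N1 N2 : nat) (s1 s2 : int) : seq idx :=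
  let p := (s1 * (2 * N1%:Z - 1), s2 * (2 * N2%:Z - 1)) in
  [:: p; mirror N1 p].

Definition umbilic_edges (N1 N2 : nat) : seq (seq idx) :=
  [seq umbilic_edge N1 N2 s1 s2 | s1 <- signs, s2 <- signs].

(** * Discrete circular cross sections *)

(* The points of U or U^* with n1 + eps n2 = s, ordered by n1 (eps = +-1). *)
Definition semicircle (N1 N2 : nat) (star : bool) (eps s : int) : seq idx :=
  [seq m <- [seq (m1, eps * (2 * s - m1)) | m1 <- zrange N1.*2]
     | inU N1 N2 star m].

(* The closed polygon, as the cyclic list of its vertices: first the polygon
   p_0, .., p_k on r^+, then the one on r^- backwards.  The end points p_0
   and p_k are shared in the primal case, and are joined to mirror p_0 and
   mirror p_k by added edges in the dual case. *)
Definition cross_section (N1 N2 : nat) (star : bool) (eps s : int) : seq idx :=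
  let p := semicircle N1 N2 star eps s in
  p ++ [seq mirror N1 m
          | m <- if star then rev p else behead (rev (behead p))].

(* |n1 + eps n2| <= N1 + N2 on U and U^*, so this lists all nonempty ones. *)
Definition cross_sections (N1 N2 : nat) (star : bool) (eps : int) :
    seq (seq idx) :=
  [seq C <- [seq cross_section N1 N2 star eps s | s <- zrange (N1 + N2)]
     | C != [::]].

Definition ends (s : seq (seq idx)) : seq (seq idx) :=
  [:: head [::] s; last [::] s].

Definition degenerations (N1 N2 : nat) : seq (seq idx) :=
  flatten [seq ends (cross_sections N1 N2 star eps)
             | star <- [:: false; true], eps <- signs].

(** * The discrete ellipsoid *)

Definition delta (R : realType) (N1 N2 : nat) : R :=
  pi / (2 * N1%:R + 2 * N2%:R - 1).

Definition amplitude (R : realType) (N1 N2 : nat) (a c : R) : R :=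
  Num.sqrt ((a - c) / cos (delta R N1 N2 / 2)).

Definition f1 (R : realType) (N1 N2 : nat) (a c : R) (m : int) : R :=
  amplitude N1 N2 a c * sin (delta R N1 N2 * half R m).
Definition h1 (R : realType) (N1 N2 : nat) (a c : R) (m : int) : R :=
  amplitude N1 N2 a c * cos (delta R N1 N2 * half R m).
Definition f2 (R : realType) (N1 N2 : nat) (a c : R) (m : int) : R :=
  amplitude N1 N2 a c * cos (delta R N1 N2 * half R m).
Definition h2 (R : realType) (N1 N2 : nat) (a c : R) (m : int) : R :=
  amplitude N1 N2 a c * sin (delta R N1 N2 * half R m).

(* The recurrences are multiplied out since g1 and g2 vanish at +-N1, +-N2;
   only the values of g at |m| <= 2 N1 (resp. 2 N2) are constrained. *)
Definition g1_solution (R : realType) (N1 N2 : nat) (a b c g0 : R)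
    (g : int -> R) : Prop :=
  g 0 = g0 /\
  forall m : int, - (2 * N1%:Z) <= m < 2 * N1%:Z ->
    g (m + 1) * g m = a - b - f1 N1 N2 a c m * f1 N1 N2 a c (m + 1).

Definition g2_solution (R : realType) (N1 N2 : nat) (a b c g0 : R)
    (g : int -> R) : Prop :=
  g 0 = g0 /\
  forall m : int, - (2 * N2%:Z) <= m < 2 * N2%:Z ->
    g (m + 1) * g m = f2 N1 N2 a c m * f2 N1 N2 a c (m + 1) - a + b.

Definition point3 (R : realType) (x y z : R) : 'rV[R]_3 :=
  \row_(i < 3) [:: x; y; z]`_i.

Definition semi_ellipsoid (R : realType) (N1 N2 : nat) (a b c f3 h3 : R)
    (g1 g2 : int -> R) (m : idx) : 'rV[R]_3 :=
  point3
    (f1 N1 N2 a c m.1 * f2 N1 N2 a c m.2 * f3 / Num.sqrt ((a - b) * (a - c)))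
    (g1 m.1 * g2 m.2 / Num.sqrt ((a - b) * (b - c)))
    (h1 N1 N2 a c m.1 * h2 N1 N2 a c m.2 * h3 / Num.sqrt ((a - c) * (b - c))).

(* g1p and g1m are the functions g_1 of r^+ and r^-. *)
Definition ellipsoid (R : realType) (N1 N2 : nat) (a b c f3 h3 : R)
    (g1p g1m g2 : int -> R) (m : idx) : 'rV[R]_3 :=
  if m.1 <= 2 * N1%:Z then semi_ellipsoid N1 N2 a b c f3 h3 g1p g2 m
  else semi_ellipsoid N1 N2 a b c f3 h3 g1m g2 (mirror N1 m).

(** * Points, lines and planes of projective 3-space *)

(* Points, lines and planes of the projective closure of R^3 are the subspaces
   of R^4 of dimension 1, 2 and 3; the points at infinity are spanned by the
   vectors with first coordinate 0. *)
Definition homog (R : realType) (x : 'rV[R]_3) : 'rV[R]_4 :=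
  row_mx (1%:M : 'M[R]_1) x.

Definition proj_span (R : realType) (X : idx -> 'rV[R]_3) (s : seq idx) :
    {vspace 'rV[R]_4} :=
  <<[seq homog (X m) | m <- s]>>%VS.

Definition box (R : realType) (N1 N2 : nat) (X : idx -> 'rV[R]_3) (m : idx) :
    {vspace 'rV[R]_4} :=
  proj_span X (dual_face N1 N2 m).

Definition umbilic_line (R : realType) (N1 N2 : nat) (X : idx -> 'rV[R]_3)
    (s1 s2 : int) : {vspace 'rV[R]_4} :=
  proj_span X [:: umbilic_vertex N1 N2 s1 s2;
                  umbilic_vertex N1 N2 (- s1) (- s2)].

(* The vertices of C that carry a plane: all but the umbilic vertices, whose
   dual faces are edges. *)
Definition with_plane (N1 N2 : nat) (C : seq idx) : seq idx :=
  [seq m <- C | m \notin umbilic_vertices N1 N2].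

(* Main.v *)
Require Import Defs.
From HB Require Import structures.
From mathcomp Require Import all_boot all_order all_algebra.
From mathcomp Require Import all_classical all_reals all_analysis.
From mathcomp Require Import zify ring lra.
Import Order.TTheory GRing.Theory Num.Theory.
Local Open Scope ring_scope.

(** Why the theorem holds.

    Write F = f_1 f_2, G = g_1 g_2, H = h_1 h_2 at a lattice point, and mark
    the value at a diagonal neighbour by a prime.  The addition theorems give
    f_i f_i' + h_i h_i' = a - c ([f1h1_adj], [f2h2_adj]), while the recurrences
    say f_1 f_1' + g_1 g_1' = a - b = f_2 f_2' - g_2 g_2'.  Eliminating the g's
    and h's, one finds
      F F'/((a-b)(a-c)) + G G'/((a-b)(b-c)) + H H'/((a-c)(b-c)) = 1,
    that is, neighbouring points are conjugate with respect to the quadric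
    x^2/f_3^2 + y^2 + z^2/h_3^2 = 1.  So the face dual to a point lies in the
    polar plane of that point ([pole_incidence]).  On the common boundary of
    the two semi-ellipsoids G = 0, the polar plane is symmetric about y = 0,
    and it therefore also contains the mirrored neighbours: the additional
    quadrilaterals created by the gluing obey the same rule.  Each face does
    span its polar plane, because it contains three points that are not
    collinear ([around_triangle], [box_front_seam]).

    Moreover F + eps H = A^2 sin(angle(n_1 + eps n_2)), where A is the common
    amplitude of the f's and h's ([ff_hh]); this is constant along a circular
    cross section.  Hence all its planes
      F x/(f_3 K1) + G y/K2 + H z/(h_3 K3) = w,
    with K1, K2, K3 the square roots in the definition of r, pass through
      x = f_3 K1,   y = 0,   z = eps h_3 K3,   w = F + eps H
    ([apex]).  The condition on a, b, c amounts to F = a - b and H = b - c at a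
    corner of U ([ab_angle], [bc_angle]), and this makes the apex a point of
    the line through two opposite umbilic vertices ([apex_umbilic_line]).  It
    is the only common point ([apex_unique]): the planes at a point and at its
    mirror image differ in the sign of G alone, which forces y = 0, and a
    further point of the section has a different value of F - eps H.

    For the degenerations, an extreme diagonal of U meets only a corner, and
    one of U^* only a corner of U^*; any other diagonal carries two lattice
    points ([on_section_other]), and these have different images because
    F - eps H separates them ([section_separated]).  All these separations rest
    on one monotonicity statement for the sine, [angle_sin_lt]. *)

(** * Angles of lattice points *)

Section Angles.
Set Implicit Arguments.
Unset Strict Implicit.
Variables (R : realType) (N1 N2 : nat).
Hypotheses (N1_gt0 : (0 < N1)%N) (N2_gt0 : (0 < N2)%N).

Definition lattice_angle (m : int) : R := delta R N1 N2 * Defs.half R m.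
Local Notation angle := lattice_angle.

(** The double index at which the angle is pi / 2.  Sums of two coordinates
    reach [quarter_turn + 1], just beyond the range where the sine is injective. *)
Definition quarter_turn : int := 2 * N1%:Z + 2 * N2%:Z - 1.
Local Notation quarter := quarter_turn.

Lemma angleE m : angle m = m%:~R * angle 1.
Proof. by rewrite /lattice_angle /Defs.half; field. Qed.

Lemma angleD m n : angle (m + n) = angle m + angle n.
Proof. by rewrite /lattice_angle /Defs.half intrD; field. Qed.

Lemma angleN m : angle (- m) = - angle m.
Proof. by rewrite /lattice_angle /Defs.half intrN; field. Qed.

Lemma angleB m n : angle (m - n) = angle m - angle n.
Proof. by rewrite angleD angleN. Qed.

Lemma quarter_gt0 : 0 < quarter.
Proof. by rewrite /quarter_turn; lia. Qed.

Lemma delta_quarter : delta R N1 N2 = pi / quarter%:~R.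
Proof.
rewrite /delta /quarter_turn; congr (_ / _).
by rewrite intrB intrD !intrM !pmulrn.
Qed.

Lemma angle_quarter : angle quarter = pi / 2.
Proof.
rewrite /lattice_angle /Defs.half delta_quarter.
have : (quarter%:~R : R) != 0 by rewrite intr_eq0 gt_eqF ?quarter_gt0.
by move=> q0; field.
Qed.

Lemma angle1_gt0 : 0 < angle 1.
Proof.
rewrite /lattice_angle /Defs.half delta_quarter.
by rewrite mulr_gt0 ?divr_gt0 ?pi_gt0 ?ltr0z ?quarter_gt0.
Qed.

Lemma angle_lt m n : (angle m < angle n) = (m < n).
Proof. by rewrite angleE (angleE n) ltr_pM2r ?angle1_gt0// ltr_int. Qed.

Lemma angle_double m : angle (2 * m) = 2 * angle m.
Proof. by rewrite (_ : 2 * m = m + m) ?angleD; ring. Qed.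

(** The difference of the sines is 2 cos((x + y) / 2) sin((y - x) / 2).  Bounding
    the sum of the two indices, rather than each of them, is what allows one of
    them to lie beyond the quarter turn. *)
Lemma angle_sin_lt m n : m < n -> `|m + n| < 2 * quarter ->
  n - m < 4 * quarter -> sin (angle m) < sin (angle n).
Proof.
move=> mn mDn mBn.
have q2 : angle (2 * quarter) = pi by rewrite angle_double angle_quarter; field.
have q4 : angle (4 * quarter) = 2 * pi.
  have -> : 4 * quarter = 2 * (2 * quarter) by lia.
  by rewrite angle_double q2.
have q2N := angleN (2 * quarter).
have := angle_lt (- (2 * quarter)) (m + n); have := angle_lt (m + n) (2 * quarter).
have := angle_lt 0 (n - m); have := angle_lt (n - m) (4 * quarter).
have -> : angle 0 = 0 by rewrite angleE mul0r.
rewrite q2N q2 q4 subr_gt0 (angleD m n) (angleB n m) mn mBn.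
have -> : m + n < 2 * quarter by lia.
have -> : - (2 * quarter) < m + n by lia.
set x := angle m; set y := angle n => y_lt y_gt s_lt s_gt.
have Ex : x = (x + y) / 2 - (y - x) / 2 by field.
have Ey : y = (x + y) / 2 + (y - x) / 2 by field.
have c_gt0 : 0 < cos ((x + y) / 2) by apply: cos_gt0_pihalf; lra.
have s_gt0 : 0 < sin ((y - x) / 2) by apply: sin_gt0_pi; lra.
have -> : sin x = sin ((x + y) / 2 - (y - x) / 2) by rewrite -Ex.
have -> : sin y = sin ((x + y) / 2 + (y - x) / 2) by rewrite -Ey.
by rewrite sinB sinD; nra.
Qed.

Lemma angle_cos_lt m n : `|m| < n -> n <= 2 * quarter ->
  cos (angle n) < cos (angle m).
Proof.
move=> mn nq.
have sinq k : cos (angle k) = sin (angle (quarter - k)).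
  by rewrite angleB angle_quarter sinB sin_pihalf cos_pihalf; ring.
by rewrite !sinq; apply: angle_sin_lt; lia.
Qed.

Lemma cos_angle1_gt0 : 0 < cos (angle 1).
Proof.
rewrite -cos_pihalf -angle_quarter; apply: angle_cos_lt; rewrite /quarter_turn; lia.
Qed.

End Angles.

(** * Sequences with prescribed products of consecutive terms *)

Section ProductRecurrence.
Set Implicit Arguments.
Unset Strict Implicit.
Variables (R : idomainType) (M : int) (C : int -> R).
Hypotheses (M_gt1 : 1 < M) (C_first : C (- M) = 0) (C_last : C (M - 1) = 0).
Hypothesis C_neq0 : forall m : int, - M < m < M - 1 -> C m != 0.

Definition product_solution (g : int -> R) : Prop :=
  forall m : int, - M <= m < M -> g (m + 1) * g m = C m.

(** Every index strictly between [- M] and [M] takes part in a product that is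
    not zero, since [1 < M]; the zero products at both ends then force zeros at
    [- M] and [M]. *)
Lemma product_solution_eq0 g (m : int) : product_solution g -> `|m| <= M ->
  (g m == 0) = (`|m| == M).
Proof.
move=> sol; have inner (k : int) : `|k| < M -> g k != 0.
  move=> kM; have [k1|k1] := boolP (k < M - 1).
    have := @C_neq0 k; rewrite -sol ?mulf_eq0 ?negb_or; last lia.
    case: (boolP (- M < k)) => [_|]; last by lia.
    by rewrite k1 => /(_ isT) /andP[].
  have := @C_neq0 (k - 1); rewrite -sol ?mulf_eq0 ?negb_or ?subrK; last lia.
  by rewrite (_ : - M < k - 1 < M - 1); [move=> /(_ isT) /andP[]|lia].
rewrite le_eqVlt; case: eqVneq => [mM _|_ /inner /negPf //].
have := sol (- M); have := sol (M - 1); rewrite C_first C_last subrK.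
rewrite (_ : - M <= M - 1 < M); last lia.
rewrite (_ : - M <= - M < M); last lia.
move=> /(_ isT)/eqP + /(_ isT)/eqP; rewrite !mulf_eq0.
rewrite (negPf (inner (M - 1) _)) ?orbF; last lia.
rewrite (negPf (inner (- M + 1) _)) ?orFb; last lia.
by have [->|->] : m = M \/ m = - M by lia.
Qed.

(** Zeros occur only at the two ends, so that a solution is determined by its
    value at [0], and its opposite is again a solution. *)
Lemma product_solution_opp g g' : product_solution g -> product_solution g' ->
  g' 0 = - g 0 -> forall m : int, `|m| <= M -> g' m = - g m.
Proof.
move=> sol sol' g0.
have inner (m : int) : `|m| < M -> g m != 0.
  by move=> mM; rewrite product_solution_eq0 //; lia.
have nat_case k : (k%:Z <= M) -> g' k%:Z = - g k%:Z /\ g' (- k%:Z) = - g (- k%:Z).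
  elim: k => [|k IH] kM; first by rewrite oppr0.
  have [IH1 IH2] := IH ltac:(lia); split.
    apply: (mulIf (inner k%:Z _)); first lia.
    have := sol k%:Z ltac:(lia); have := sol' k%:Z ltac:(lia).
    rewrite (_ : k%:Z + 1 = k.+1%:Z); last lia.
    by rewrite IH1 mulrN mulNr => <- ->; rewrite opprK.
  apply: (mulfI (inner (- k%:Z) _)); first lia.
  have := sol (- k.+1%:Z) ltac:(lia); have := sol' (- k.+1%:Z) ltac:(lia).
  rewrite (_ : - k.+1%:Z + 1 = - k%:Z); last lia.
  by rewrite IH2 mulNr mulrN => <- ->; rewrite opprK.
move=> m mM; have [n n0] : exists n : nat, n%:Z = `|m| by exists `|m|%N; lia.
have [n1 n2] := nat_case n ltac:(lia).
by have [->|->] : m = n%:Z \/ m = - n%:Z by lia.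
Qed.

End ProductRecurrence.

(** * Polar planes in projective space *)

Section ProjectiveSpace.
Set Implicit Arguments.
Unset Strict Implicit.
Variable R : realType.
Implicit Types (u v x y z : 'rV[R]_3) (P Q : 'rV[R]_4).

Definition dot u v : R := (u *m v^T) 0 0.

Lemma dotE u v : dot u v =
  u 0 0 * v 0 0 + u 0 1 * v 0 1 + u 0 2%:R * v 0 2%:R.
Proof.
rewrite /dot mxE !big_ord_recl big_ord0 addr0 !mxE -addrA.
by congr (_ + (_ + _)); congr (u _ _ * v _ _); apply/val_inj.
Qed.

Lemma dotDl u v w : dot (u + v) w = dot u w + dot v w.
Proof. by rewrite /dot mulmxDl mxE. Qed.
Lemma dotZl k u w : dot (k *: u) w = k * dot u w.
Proof. by rewrite /dot -scalemxAl mxE. Qed.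

Definition weight P : R := P 0 0.
Definition space_part P : 'rV[R]_3 := @rsubmx _ 1 1 3 P.
Definition proj_point (w : R) x : 'rV[R]_4 := row_mx (w%:M : 'M[R]_1) x.

Definition polar_form u P : R^o := dot (space_part P) u - weight P.

Lemma polar_form_linear u : linear (polar_form u).
Proof.
move=> k P Q; rewrite /polar_form /space_part /weight linearP !mxE dotDl dotZl.
by rewrite /GRing.scale /=; ring.
Qed.
HB.instance Definition _ u := GRing.isLinear.Build R 'rV[R]_4 R^o *:%R
  (polar_form u) (polar_form_linear u).

(** The points (w, x) with <x, u> = w: the polar plane of the point u for the
    unit sphere.  Any ellipsoid in normal form is covered by rescaling the
    coordinates of u. *)
Definition polar_plane u : {vspace 'rV[R]_4} := lker (linfun (polar_form u)).

Lemma mem_polar_plane u P :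
  (P \in polar_plane u) = (dot (space_part P) u == weight P).
Proof. by rewrite memv_ker lfunE /= /polar_form subr_eq0. Qed.

Lemma weight_point w x : weight (proj_point w x) = w.
Proof.
transitivity ((w%:M : 'M[R]_1) 0 0); last by rewrite mxE.
rewrite -(row_mxEl (w%:M : 'M[R]_1) x) /weight /proj_point.
by congr (row_mx _ _ _ _); apply/val_inj.
Qed.

Lemma space_part_point w x : space_part (proj_point w x) = x.
Proof. exact: row_mxKr. Qed.

Lemma proj_pointK P : proj_point (weight P) (space_part P) = P.
Proof.
have lP : @lsubmx _ 1 1 3 P = (weight P)%:M.
  rewrite [LHS]mx11_scalar mxE; congr ((P _ _)%:M).
  exact/val_inj.
by rewrite -[RHS](@hsubmxK _ 1 1 3) lP.
Qed.

Lemma proj_pointD w x w' x' :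
  proj_point w x + proj_point w' x' = proj_point (w + w') (x + x').
Proof.
have := add_row_mx (w%:M : 'M[R]_1) x (w'%:M : 'M[R]_1) x'.
by rewrite -raddfD /proj_point => <-.
Qed.

Lemma proj_pointZ k w x : k *: proj_point w x = proj_point (k * w) (k *: x).
Proof.
by have := scale_row_mx k (w%:M : 'M[R]_1) x; rewrite scale_scalar_mx /proj_point => <-.
Qed.

Lemma proj_point_eq0 w x : (proj_point w x == 0) = (w == 0) && (x == 0).
Proof.
apply/eqP/andP => [E|[/eqP-> /eqP->]].
  have := congr1 weight E; have := congr1 space_part E.
  by rewrite weight_point space_part_point /weight /space_part linear0 mxE => -> ->.
by rewrite -(proj_pointK 0) /weight /space_part linear0 mxE.
Qed.

Lemma homogE x : homog x = proj_point 1 x. Proof. by []. Qed.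

Lemma dim_polar_plane u : \dim (polar_plane u) = 3%N.
Proof.
have := limg_ker_dim (linfun (polar_form u)) fullv.
rewrite capfv -/(polar_plane u).
have -> : \dim {:'rV[R]_4} = 4%N by rewrite dimvf /dim /= mul1n.
have : (\dim (limg (linfun (polar_form u))) <= 1)%N.
  by rewrite -[X in (_ <= X)%N](_ : \dim {:R^o} = 1%N) ?dimvS ?subvf ?dimvf.
suff : (\dim (polar_plane u) < 4)%N.
  case: (\dim (polar_plane u)) => [|[|[|[|d]]]] //; by case: (\dim _) => [|[|]].
rewrite ltnNge; apply/negP => dim4.
have /eqP full : polar_plane u == fullv.
  by rewrite eqEdim subvf dimvf /dim /= mul1n.
have := memvf (proj_point 1 0); rewrite -full mem_polar_plane.
by rewrite space_part_point weight_point /dot mul0mx mxE eq_sym oner_eq0.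
Qed.

(** Three points are not collinear when a linear form separates the first from
    two distinct ones on which it agrees. *)
Lemma free_homog_triple x y z n : dot y n = dot z n -> dot x n != dot y n ->
  y != z -> free [:: homog x; homog y; homog z].
Proof.
move=> yzn xyn yz; apply/(@freeP _ _ 3 [tuple homog x; homog y; homog z]) => k.
rewrite !big_ord_recl big_ord0 addr0 /= !homogE.
rewrite !proj_pointZ !proj_pointD => /eqP; rewrite proj_point_eq0.
set i0 : 'I_3 := ord0; set i1 := lift _ _; set i2 := lift _ _.
rewrite !mulr1 => /andP[/eqP k0 /eqP kx].
have := congr1 (dot^~ n) kx; rewrite /= !dotDl !dotZl -yzn.
have -> : dot 0 n = 0 by rewrite /dot mul0mx mxE.
move=> kn; have ki0 : k i0 = 0.
  have /eqP : k i0 * (dot x n - dot y n) = 0.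
    have -> : k i0 * (dot x n - dot y n) =
      (k i0 * dot x n + (k i1 * dot y n + k i2 * dot y n))
      - (k i0 + (k i1 + k i2)) * dot y n by ring.
    by rewrite kn k0 mul0r subr0.
  by rewrite mulf_eq0 subr_eq0 (negPf xyn) orbF => /eqP.
move: k0 kx; rewrite ki0 add0r scale0r add0r => /eqP.
rewrite addr_eq0 => /eqP ki1; rewrite ki1 scaleNr addrC => /eqP.
rewrite subr_eq0 => /eqP kyz.
have ki2 : k i2 = 0.
  apply/eqP/negPn/negP => ki2; move/eqP: yz; apply.
  by have := congr1 (fun v => (k i2)^-1 *: v) kyz; rewrite !scalerA mulVf // !scale1r.
move=> i; have [->|->|->] : [\/ i = i0, i = i1 | i = i2] => //.
  by case: i => [[|[|[|]]]] // ?; [constructor 1|constructor 2|constructor 3]; apply/val_inj.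
by rewrite ki1 ki2 oppr0.
Qed.

Lemma span_homog_polar (s : seq 'rV[R]_3) u x y z n :
  (forall t, t \in s -> dot t u = 1) -> {subset [:: x; y; z] <= s} ->
  dot y n = dot z n -> dot x n != dot y n -> y != z ->
  <<[seq homog t | t <- s]>>%VS = polar_plane u.
Proof.
move=> su xyz yzn xyn yz; apply/eqP.
have sub : (<<[seq homog t | t <- s]>> <= polar_plane u)%VS.
  apply/span_subvP => _ /mapP[t ts ->]; rewrite mem_polar_plane homogE.
  by rewrite space_part_point weight_point su.
rewrite eqEdim sub dim_polar_plane.
have := free_homog_triple yzn xyn yz; rewrite /free => /eqP fr.
rewrite -[leqLHS]fr.
apply/dimvS/span_subvP => _ /(@mapP _ _ _ [:: x; y; z])[t ts ->].
by apply/memv_span/map_f/xyz.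
Qed.

End ProjectiveSpace.

(** * Ranges, neighbours and reflection of indices *)

Section Sequences.
Set Implicit Arguments.
Unset Strict Implicit.

(** [behead (rev (behead p))] is how the end points are removed from a
    semicircle before reflecting it. *)
Lemma sorted_inner (T : eqType) (r : rel T) (p : seq T) q :
  transitive r -> sorted r p -> q \in behead (rev (behead p)) ->
  exists x y, [/\ x \in p, y \in p, r x q & r q y].
Proof.
move=> r_tr; case: p => //= x p; case/lastP: p => [|p y] //.
rewrite rev_rcons /= mem_rev => + qp; move=> xpy.
exists x, y; rewrite mem_head inE mem_rcons mem_head orbT; split=> //.
  by apply: (allP (order_path_min r_tr xpy)); rewrite mem_rcons inE qp orbT.
move: xpy; case/splitPr: qp => p1 p2; rewrite rcons_cat cat_path /= => /and3P[_ _].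
by move=> /(order_path_min r_tr)/allP; apply; rewrite mem_rcons mem_head.
Qed.

Lemma uniq_singleton (T : eqType) (x : T) (s : seq T) :
  uniq s -> s =i [:: x] -> s = [:: x].
Proof.
move=> us sx; apply/perm_small_eq => //; exact: uniq_perm.
Qed.

Lemma signsP (e : int) : e \in signs -> e = 1 \/ e = -1.
Proof. by rewrite !inE => /orP[]/eqP; [left|right]. Qed.

Lemma mem_zrange n (k : int) : (k \in zrange n) = (`|k| <= n%:Z).
Proof.
apply/mapP/idP => [[i]|kn]; first by rewrite mem_iota => ? ->; lia.
by exists `|(k + n%:Z)%R|%N; [rewrite mem_iota|]; lia.
Qed.

Lemma zrange_sorted n : sorted <%R (zrange n).
Proof.
rewrite /zrange sorted_map; apply: sub_sorted (iota_ltn_sorted 0 _) => i j /=.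
lia.
Qed.

Lemma zrange_cons n : zrange n.+1 = - n.+1%:Z :: - n%:Z :: behead (behead (zrange n.+1)).
Proof. by rewrite /zrange doubleS /=; congr [:: _, _ & _]; lia. Qed.

Lemma zrange_rcons n : exists r, zrange n.+1 = rcons (rcons r n%:Z) n.+1%:Z.
Proof.
exists [seq k%:Z - n.+1%:Z | k <- iota 0 (n.*2.+1)].
rewrite /zrange doubleS -[n.*2.+3](addn2 n.*2.+1) iotaD map_cat -!cats1 -catA.
by congr (_ ++ [:: _; _]); lia.
Qed.

Lemma mem_around (m w : idx) :
  (w \in around m) = (`|w.1 - m.1| == 1) && (`|w.2 - m.2| == 1).
Proof.
by case: m w => m1 m2 [w1 w2]; rewrite /around /= !inE !xpair_eqE /=; lia.
Qed.

Lemma parity_around star (m w : idx) : parity star m -> w \in around m ->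
  parity (~~ star) w.
Proof. by rewrite mem_around /parity; case: star; lia. Qed.

Lemma mirrorK N1 (m : idx) : mirror N1 (mirror N1 m) = m.
Proof. by case: m => m1 m2; rewrite /mirror /=; congr pair; ring. Qed.

End Sequences.

(** * Diagonals of the lattice, cross sections and dual faces *)

Section Lattice.
Set Implicit Arguments.
Unset Strict Implicit.
Variables (N1 N2 : nat).
Hypotheses (N1_gt0 : (0 < N1)%N) (N2_gt0 : (0 < N2)%N).
Implicit Types (star : bool) (eps s : int) (m q : idx).

(** The box of U, without a condition on parities: neighbouring vertices of the
    primal and of the dual lattice are treated alike. *)
Definition inbox q : bool := (`|q.1| <= 2 * N1%:Z) && (`|q.2| <= 2 * N2%:Z).
(** Off the boundary along which the two semi-ellipsoids are glued. *)
Definition off_seam q : bool := (`|q.1| < 2 * N1%:Z) && (`|q.2| < 2 * N2%:Z).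
Definition on_section star eps s q : bool :=
  inU N1 N2 star q && (q.1 + eps * q.2 == 2 * s).

Definition end_point star eps (t : int) : idx :=
  (t * (2 * N1%:Z - star%:Z), eps * t * (2 * N2%:Z - star%:Z)).

Lemma mem_semicircle star eps s m : eps \in signs ->
  (m \in semicircle N1 N2 star eps s) = on_section star eps s m.
Proof.
case: m => m1 m2 /signsP epsE; rewrite mem_filter /on_section.
apply: andb_id2l; rewrite /inU => /and3P[_ m1N _].
apply/mapP/eqP => /= [[k _ [-> ->]]|E]; first by case: epsE => ->; lia.
exists m1; first by rewrite mem_zrange; move: m1N => /=; lia.
by congr pair; case: epsE E => ->; lia.
Qed.

Lemma semicircle_sorted star eps s :
  sorted (fun m q : idx => m.1 < q.1) (semicircle N1 N2 star eps s).
Proof.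
apply: sorted_filter; first by move=> ? ? ?; exact: lt_trans.
by rewrite sorted_map; exact: zrange_sorted.
Qed.

Lemma semicircle_uniq star eps s : uniq (semicircle N1 N2 star eps s).
Proof.
apply: sorted_uniq (semicircle_sorted _ _ _); first by move=> ? ? ?; exact: lt_trans.
by move=> ?; rewrite ltxx.
Qed.

(** A point strictly between two points of the same diagonal cannot lie on the
    boundary of U. *)
Lemma section_inner star eps s q : eps \in signs ->
  q \in behead (rev (behead (semicircle N1 N2 star eps s))) -> off_seam q.
Proof.
move=> eps1 qp.
have [|x [y [xp yp]]] := sorted_inner _ (semicircle_sorted star eps s) qp.
  by move=> ? ? ?; exact: lt_trans.
have := mem_behead qp; rewrite mem_rev => /mem_behead qp'.
move: xp yp qp'; rewrite !mem_semicircle // /on_section /inU /off_seam.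
by case: (signsP eps1) => ->; lia.
Qed.

(** Only points off the seam are reflected: the primal polygons share their end
    points, and the dual lattice does not meet the seam. *)
Lemma mem_cross_section star eps s m : eps \in signs ->
  m \in cross_section N1 N2 star eps s ->
  exists2 q, on_section star eps s q & m = q \/ m = mirror N1 q /\ off_seam q.
Proof.
move=> eps1; rewrite mem_cat => /orP[|/mapP[q]].
  by rewrite mem_semicircle // => ?; exists m => //; left.
case: star => qp ->; exists q; last 1 first.
- by right; split=> //; exact: section_inner qp.
- by move: qp; rewrite mem_rev mem_semicircle.
- right; split => //; move: qp; rewrite mem_rev mem_semicircle //.
  by rewrite /on_section /inU /off_seam; lia.
by have := mem_behead qp; rewrite mem_rev => /mem_behead; rewrite mem_semicircle.
Qed.

Lemma section_neq0 star eps s : eps \in signs ->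
  cross_section N1 N2 star eps s != [::] ->
  exists q, on_section star eps s q.
Proof.
move=> eps1; case E: cross_section => [|m C] // _.
have [|q ? _] := @mem_cross_section star eps s m eps1; last by exists q.
by rewrite E mem_head.
Qed.

Lemma on_section_bound star eps s q : eps \in signs -> on_section star eps s q ->
  `|s| <= N1%:Z + N2%:Z - star%:Z.
Proof.
by rewrite /on_section /inU; case/signsP=> ->; case: star; lia.
Qed.

(** At the largest possible |n_1 + eps n_2| both coordinates are extreme. *)
Lemma on_section_end star eps t q : eps \in signs -> t \in signs ->
  on_section star eps (t * (N1%:Z + N2%:Z - star%:Z)) q =
  (q == end_point star eps t).
Proof.
case: q => q1 q2; rewrite /on_section /inU /parity /end_point xpair_eqE /=.
by case/signsP=> -> /signsP[->|->]; case: star; apply/idP/idP; lia.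
Qed.

Lemma on_section_step_mem star eps s (i j e : int) : eps \in signs ->
  e = 2 \/ e = -2 -> on_section star eps s (i, j) ->
  `|i + e| <= 2 * N1%:Z - star%:Z -> `|j - eps * e| <= 2 * N2%:Z - star%:Z ->
  exists2 q', on_section star eps s q' & q' != (i, j).
Proof.
move=> /signsP eps1 e2 /andP[/and3P[/andP[/= ip jp] _ _] /eqP /= ij] iN jN.
have odd_step (k d : int) : d = 2 \/ d = -2 -> odd `|(k + d)%R|%N = odd `|k|%N.
  by move=> d2; clear - d2; lia.
exists (i + e, j - eps * e); last by rewrite xpair_eqE; move: e2; clear; lia.
apply/andP; split; last by apply/eqP; case: eps1 ij => -> /=; clear; lia.
apply/and3P; split=> //; rewrite /parity /= odd_step // ip odd_step //.
by case: eps1 => ->; move: e2; clear; lia.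
Qed.

(** On a diagonal that is not extreme, one diagonal step forwards or backwards
    stays inside the lattice: by parity a coordinate is either extreme or at
    least two units away from the extreme, and if each of the two steps is
    blocked by one of the coordinates, then the point is a corner of an extreme
    diagonal. *)
Lemma on_section_other star eps s q : eps \in signs -> on_section star eps s q ->
  `|s| < N1%:Z + N2%:Z - star%:Z ->
  exists2 q', on_section star eps s q' & q' != q.
Proof.
case: q => i j eps1 q_on s_lt; have step := on_section_step_mem eps1 _ q_on.
have /andP[/and3P[/andP[/= ip jp] /= iN jN] /eqP /= ij] := q_on.
have not_penultimate (k : int) (n : nat) : (0 < n)%N ->
    odd `|k|%N == star -> `|k| <= 2 * n%:Z - star%:Z ->
    `|k| = 2 * n%:Z - star%:Z \/ `|k| <= 2 * n%:Z - star%:Z - 2.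
  by clear; case: star; lia.
have iN' := not_penultimate _ _ N1_gt0 ip iN.
have jN' := not_penultimate _ _ N2_gt0 jp jN.
have big1 : 1 <= 2 * N1%:Z - star%:Z by move: N1_gt0; clear; case: star; lia.
have big2 : 1 <= 2 * N2%:Z - star%:Z by move: N2_gt0; clear; case: star; lia.
have s2_lt : `|2 * s| < 2 * N1%:Z - star%:Z + (2 * N2%:Z - star%:Z).
  by move: s_lt; clear; case: star; lia.
move: step ij iN iN' jN jN' big1 big2 s2_lt.
move: (2 * N1%:Z - star%:Z) (2 * N2%:Z - star%:Z) (2 * s) => M1 M2 s2.
case: (signsP eps1) => ->; clear => step ij iN iN' jN jN' big1 big2 s2_lt.
  have [fwd|fwd] := boolP ((i + 2 <= M1) && (- M2 <= j - 2)).
    by apply: (step 2); first (by left); clear step; lia.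
  by apply: (step (-2)); first (by right); clear step; lia.
have [fwd|fwd] := boolP ((i + 2 <= M1) && (j + 2 <= M2)).
  by apply: (step 2); first (by left); clear step; lia.
by apply: (step (-2)); first (by right); clear step; lia.
Qed.

Definition end_section star eps (t : int) : seq idx :=
  if star then [:: end_point true eps t; mirror N1 (end_point true eps t)]
  else [:: end_point false eps t].

Lemma cross_section_end star eps t : eps \in signs -> t \in signs ->
  cross_section N1 N2 star eps (t * (N1%:Z + N2%:Z - star%:Z)) =
  end_section star eps t.
Proof.
move=> eps1 t1; rewrite /cross_section.
have -> : semicircle N1 N2 star eps (t * (N1%:Z + N2%:Z - star%:Z)) =
    [:: end_point star eps t].
  apply: uniq_singleton; first exact: semicircle_uniq.
  by move=> q; rewrite mem_semicircle // on_section_end // inE.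
by rewrite /end_section; case: star.
Qed.

Lemma cross_section_nil eps t : eps \in signs -> t \in signs ->
  cross_section N1 N2 true eps (t * (N1%:Z + N2%:Z)) = [::].
Proof.
move=> eps1 t1; apply/eqP/negPn/negP => /(section_neq0 eps1)[q].
move=> /(on_section_bound eps1).
by case/signsP: t1 => ->; lia.
Qed.

(** The first and the last parameter give polygons that are empty on the dual
    lattice, so that there the ends of the list sit one position further in. *)
Lemma cross_sections_ends star eps : eps \in signs ->
  ends (cross_sections N1 N2 star eps) =
  [:: end_section star eps (-1); end_section star eps 1].
Proof.
move=> eps1; have end_neq0 t : end_section star eps t != [::] by case: (star).
rewrite /ends /cross_sections.
have [n nE] : exists n, (N1 + N2)%N = n.+1 by exists (N1 + N2).-1; lia.
rewrite nE; congr [:: _; _].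
  rewrite zrange_cons /=.
  have := @cross_section_end star eps (-1) eps1 isT.
  have := @cross_section_nil eps (-1) eps1 isT.
  case: (star) => [nil|_].
    rewrite (_ : - n.+1%:Z = -1 * (N1%:Z + N2%:Z)); last lia.
    rewrite nil /= (_ : - n%:Z = -1 * (N1%:Z + N2%:Z - true%:Z)); last lia.
    by move=> ->.
  rewrite (_ : - n.+1%:Z = -1 * (N1%:Z + N2%:Z - false%:Z)); last lia.
  by move=> ->.
have [r ->] := zrange_rcons n; rewrite !map_rcons !filter_rcons.
have := @cross_section_end star eps 1 eps1 isT.
have := @cross_section_nil eps 1 eps1 isT.
case: (star) => [nil|_].
  rewrite (_ : n.+1%:Z = 1 * (N1%:Z + N2%:Z)); last lia.
  rewrite nil /= (_ : n%:Z = 1 * (N1%:Z + N2%:Z - true%:Z)); last lia.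
  by move=> -> /=; rewrite last_rcons.
rewrite (_ : n.+1%:Z = 1 * (N1%:Z + N2%:Z - false%:Z)); last lia.
by move=> -> /=; rewrite last_rcons.
Qed.

Lemma end_section_umbilic star eps t :
  end_section star eps t =
  if star then umbilic_edge N1 N2 t (eps * t)
  else [:: umbilic_vertex N1 N2 t (eps * t)].
Proof. by rewrite /end_section /end_point !subr0. Qed.

Lemma degenerations_umbilic : degenerations N1 N2 =i
  [seq [:: u] | u <- umbilic_vertices N1 N2] ++ umbilic_edges N1 N2.
Proof.
move=> C; rewrite /degenerations /umbilic_edges /umbilic_vertices /signs.
cbn [flatten foldr map cat]; rewrite !cross_sections_ends //.
rewrite !end_section_umbilic !mul1r !mulr1 mulrNN mulr1 !mem_cat !inE.
by do 8 case: (C == _) => //=.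
Qed.

Lemma section_two_points star eps s : eps \in signs ->
  cross_section N1 N2 star eps s != [::] ->
  cross_section N1 N2 star eps s \notin ends (cross_sections N1 N2 star eps) ->
  exists q q', [/\ q != q', on_section star eps s q & on_section star eps s q'].
Proof.
move=> eps1 /(section_neq0 eps1)[q q_on]; rewrite cross_sections_ends //.
move=> not_end; have s_bound := on_section_bound eps1 q_on.
have [q' q'_on qq'] : exists2 q', on_section star eps s q' & q' != q.
  apply: on_section_other q_on _ => //; rewrite lt_neqAle s_bound andbT.
  apply: contraNneq not_end => sE; rewrite !inE -!cross_section_end //.
  have [->|->] : s = -1 * (N1%:Z + N2%:Z - star%:Z) \/
                 s = 1 * (N1%:Z + N2%:Z - star%:Z) by lia.
    by rewrite eqxx.
  by rewrite eqxx orbT.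
by exists q', q.
Qed.

Lemma on_section_mem star eps s q : eps \in signs -> on_section star eps s q ->
  q \in cross_section N1 N2 star eps s.
Proof. by move=> eps1 q_on; rewrite mem_cat mem_semicircle // q_on. Qed.

Lemma on_section_mem_mirror eps s q : eps \in signs -> on_section true eps s q ->
  mirror N1 q \in cross_section N1 N2 true eps s.
Proof.
move=> eps1 q_on; rewrite mem_cat map_f ?orbT //.
by rewrite mem_rev mem_semicircle // q_on.
Qed.

Lemma off_seam_with_plane C q : off_seam q -> q \in C -> q \in with_plane N1 N2 C.
Proof.
case: q => q1 q2; rewrite /off_seam mem_filter => q_in ->; rewrite andbT.
rewrite !inE !xpair_eqE; move: q_in => /=; lia.
Qed.

Lemma mirror_with_plane C q : off_seam q -> mirror N1 q \in C ->
  mirror N1 q \in with_plane N1 N2 C.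
Proof.
case: q => q1 q2; rewrite /off_seam mem_filter => q_in ->; rewrite andbT.
rewrite !inE !xpair_eqE; move: q_in => /=; lia.
Qed.

(** The situation in which the apex is unique: a vertex off the seam with its
    mirror image, and one more vertex carrying a plane.  A primal polygon with
    three vertices on r^+ has only one of them off the seam, and its end points
    may be umbilic: counting the planes excludes the case where both are. *)
Lemma large_section star eps s : eps \in signs ->
  (2 < size (with_plane N1 N2 (cross_section N1 N2 star eps s)))%N ->
  exists q q', [/\ on_section star eps s q, on_section star eps s q', q != q' &
    [/\ off_seam q, q \in with_plane N1 N2 (cross_section N1 N2 star eps s),
      mirror N1 q \in with_plane N1 N2 (cross_section N1 N2 star eps s) &
      q' \in with_plane N1 N2 (cross_section N1 N2 star eps s)]].
Proof.
move=> eps1 size_gt2.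
have := semicircle_uniq star eps s.
have := size_gt2; rewrite size_filter => /leq_trans/(_ (count_size _ _)).
have on_sec q : q \in semicircle N1 N2 star eps s -> on_section star eps s q.
  by rewrite mem_semicircle.
case: star size_gt2 on_sec => size_gt2 on_sec.
  rewrite {1}/cross_section size_cat size_map size_rev.
  have all_in q : on_section true eps s q -> [/\ off_seam q,
      q \in with_plane N1 N2 (cross_section N1 N2 true eps s) &
      mirror N1 q \in with_plane N1 N2 (cross_section N1 N2 true eps s)].
    move=> q_on; have q_in : off_seam q.
      by move: q_on; rewrite /on_section /inU /off_seam; lia.
    split=> //; first by apply: off_seam_with_plane => //; exact: on_section_mem.
    by apply: mirror_with_plane => //; exact: on_section_mem_mirror.
  case: semicircle on_sec => [|x [|y p]] //= on_sec _ /andP[+ _].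
  rewrite inE negb_or => /andP[xy _].
  have x_on : on_section true eps s x by apply: on_sec; rewrite mem_head.
  have y_on : on_section true eps s y by apply: on_sec; rewrite !inE eqxx orbT.
  have [x_in xC x'C] := all_in _ x_on; have [_ yC _] := all_in _ y_on.
  by exists x, y.
have := @section_inner false eps s _ eps1.
move: size_gt2; rewrite /cross_section.
case: semicircle on_sec => [|x [|y [|z p]]] // on_sec size_gt2 inner _.
rewrite [uniq _]/= !inE !negb_or => /and3P[/andP[xy _] /andP[yz _] _].
have mem_inner q : q \in belast y (z :: p) ->
  q \in behead (rev (behead [:: x, y, z & p])).
  by move=> qp; rewrite [behead _]/= lastI rev_rcons [behead _]/= mem_rev.
have y_in := inner _ (mem_inner _ (mem_head _ _)).
(* The second point y is off the seam; the end points may be umbilic. *)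
exists y.
suff [q' q'p [yq' q'umb]] : exists2 q', q' \in [:: x, y, z & p] &
    y != q' /\ q' \notin umbilic_vertices N1 N2.
  exists q'; split=> //; [|exact: on_sec|split=> //].
  - by apply: on_sec; rewrite !inE eqxx orbT.
  - by apply: off_seam_with_plane => //; rewrite mem_cat !inE eqxx orbT.
  - apply: mirror_with_plane => //; rewrite mem_cat; apply/orP; right.
    exact/map_f/mem_inner/mem_head.
  by rewrite mem_filter q'umb mem_cat q'p.
have [x_umb|] := boolP (x \in umbilic_vertices N1 N2); last first.
  by exists x; [rewrite mem_head|rewrite eq_sym].
exists z; [by rewrite !inE eqxx !orbT|split=> //].
apply/negP => z_umb; move: size_gt2; rewrite /with_plane filter_cat /= x_umb z_umb /=.
case: p inner mem_inner {on_sec} => [|w p] inner mem_inner.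
  rewrite /rev /=; by do 2 case: ifP.
have z_in : off_seam z by apply/inner/mem_inner; rewrite !inE eqxx orbT.
have := @off_seam_with_plane [:: z] z z_in (mem_head _ _).
by rewrite mem_filter z_umb.
Qed.

Lemma mem_dual_face m w : (w \in dual_face N1 N2 m) =
  ((w \in around m) || (w \in around (Defs.glue N1 N2 m)))
  && (inV N1 N2 w || inVstar N1 N2 w).
Proof. by rewrite mem_filter mem_undup mem_cat andbC. Qed.

(** The index in the box of U over which a vertex of the ellipsoid lies. *)
Definition front_index (w : idx) : idx :=
  if w.1 <= 2 * N1%:Z then w else mirror N1 w.

Lemma inU_inbox star q : inU N1 N2 star q -> inbox q.
Proof. by rewrite /inU /inbox; lia. Qed.

Lemma inV_box (w : idx) : inV N1 N2 w || inVstar N1 N2 w ->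
  (- (2 * N1%:Z) <= w.1 <= 6 * N1%:Z) && (`|w.2| <= 2 * N2%:Z).
Proof. by rewrite /inV /inVstar; lia. Qed.

Lemma parity_mirror star m : parity star (mirror N1 m) = parity star m.
Proof. by rewrite /parity /mirror /=; case: star; lia. Qed.

Lemma inV_inbox star (w : idx) : parity star w -> inbox w ->
  (star -> off_seam w) ->
  (inV N1 N2 w || inVstar N1 N2 w) &&
  (inV N1 N2 (mirror N1 w) || inVstar N1 N2 (mirror N1 w)).
Proof.
rewrite /inV /inVstar !parity_mirror => par; case: star par => par.
  move=> _ /(_ isT); rewrite par /off_seam /=; lia.
move=> + _; rewrite par /inbox /=; lia.
Qed.

Lemma glue_off_seam m : off_seam m -> Defs.glue N1 N2 m = m.
Proof.
by case: m => m1 m2; rewrite /off_seam /Defs.glue !inE /= => m_in; case: ifP => //; lia.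
Qed.

Lemma glue_mirror_off_seam m :
  off_seam m -> Defs.glue N1 N2 (mirror N1 m) = mirror N1 m.
Proof.
by case: m => m1 m2; rewrite /off_seam /Defs.glue !inE /= => m_in; case: ifP => //; lia.
Qed.

Lemma glue_boundary m : inbox m -> ~~ off_seam m -> Defs.glue N1 N2 m = mirror N1 m.
Proof.
by case: m => m1 m2; rewrite /inbox /off_seam /Defs.glue !inE /= => ? ?; case: ifP => //; lia.
Qed.

(** A dual face extends to the second semi-ellipsoid only across the seam. *)
Lemma dual_face_front star q (w : idx) : inU N1 N2 star q ->
  w \in dual_face N1 N2 q ->
  [/\ front_index w \in around q, inbox (front_index w) &
      2 * N1%:Z < w.1 -> ~~ off_seam q].
Proof.
move=> q_in; have qU := q_in; move/inU_inbox: qU => q_box.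
rewrite mem_dual_face => /andP[wq /inV_box wV].
have [q_int|q_bd] := boolP (off_seam q).
  move: wq; rewrite glue_off_seam // orbb => wq.
  have w_nb : (`|w.1 - q.1| == 1) && (`|w.2 - q.2| == 1) by rewrite -mem_around.
  have w1 : w.1 <= 2 * N1%:Z by move: q_int; rewrite /off_seam; lia.
  rewrite /front_index w1 wq; split=> //; last by move: w1; lia.
  by move: q_int; rewrite /off_seam /inbox; lia.
move: wq; rewrite glue_boundary // !mem_around /mirror /= => wq.
have pq : (`|q.1| == 2 * N1%:Z) || (`|q.2| == 2 * N2%:Z).
  by move: q_bd q_box; rewrite /off_seam /inbox; lia.
by rewrite /front_index; case: ifPn => w1; rewrite /inbox /mirror /=;
  split => //; move: q_box; rewrite /inbox /=; lia.
Qed.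

Lemma dual_face_back q (w : idx) : off_seam q ->
  w \in dual_face N1 N2 (mirror N1 q) ->
  (mirror N1 w \in around q) && inbox (mirror N1 w).
Proof.
move=> q_int; rewrite mem_dual_face glue_mirror_off_seam // orbb => /andP[+ /inV_box].
by move: q_int; rewrite /off_seam /inbox !mem_around /mirror /=; lia.
Qed.

Lemma around_off_seam star q (v : idx) : inU N1 N2 star q -> off_seam q ->
  v \in around q ->
  v \in dual_face N1 N2 q /\ mirror N1 v \in dual_face N1 N2 (mirror N1 q).
Proof.
move=> q_in q_int vq; have /and3P[par _ _] := q_in.
have v_par := parity_around par vq.
have /andP[vV v'V] : (inV N1 N2 v || inVstar N1 N2 v) &&
  (inV N1 N2 (mirror N1 v) || inVstar N1 N2 (mirror N1 v)).
  apply: (inV_inbox v_par).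
    by move: q_int vq; rewrite mem_around /off_seam /inbox; lia.
  move: q_in q_int vq; rewrite mem_around /inU /parity /off_seam.
  by case: star {par v_par}; lia.
rewrite !mem_dual_face vq vV v'V; split=> //.
by apply/andP; split=> //; apply/orP; left; move: vq; rewrite !mem_around /=; lia.
Qed.

(** At a seam vertex other than a corner the dual face is an additional
    quadrilateral, made of two neighbours and their mirror images. *)
Lemma around_boundary star q (v : idx) : inU N1 N2 star q -> ~~ off_seam q ->
  v \in around q -> off_seam v ->
  v \in dual_face N1 N2 q /\ mirror N1 v \in dual_face N1 N2 q.
Proof.
move=> q_in q_bd vq v_int; have /and3P[par _ _] := q_in.
have v_par := parity_around par vq.
have v_box : inbox v by move: v_int; rewrite /off_seam /inbox; lia.
have /andP[vV v'V] := inV_inbox v_par v_box (fun=> v_int).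
rewrite !mem_dual_face vq vV v'V; split=> //.
rewrite andbT glue_boundary ?(inU_inbox q_in) //; apply/orP; right.
by move: vq; rewrite !mem_around /=; lia.
Qed.

Lemma off_seam_inbox q : off_seam q -> inbox q.
Proof. by rewrite /off_seam /inbox; lia. Qed.

(** Parity keeps the double index of a boundary vertex other than a corner two
    units away from the corners, so that both neighbours inside U are off the
    seam. *)
Lemma seam_neighbours star q : inU N1 N2 star q -> ~~ off_seam q ->
  q \notin umbilic_vertices N1 N2 ->
  exists v v' : idx, [/\ v \in around q, v' \in around q, off_seam v,
    off_seam v' & v'.1 + v'.2 = v.1 + v.2 + 2].
Proof.
case: q => q1 q2; rewrite /inU /off_seam !inE !xpair_eqE /= => qU q_seam q_umb.
have star0 : star = false by move: qU q_seam; rewrite /parity; case: star => //=; lia.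
move: qU; rewrite star0 /parity /= => qU.
have [q1N|q1N] := boolP (`|q1| == 2 * N1%:Z).
  have q2N : `|q2| <= 2 * N2%:Z - 2 by move: qU q_umb q1N; clear; lia.
  have [e [e1 qe]] : exists e : int, `|e| = 1 /\ `|q1 - e| < 2 * N1%:Z.
    by case: (leP 0 q1) => sq; [exists 1|exists (-1)];
      move: sq qU q1N N1_gt0; clear; lia.
  exists (q1 - e, q2 - 1), (q1 - e, q2 + 1); rewrite !mem_around /=.
  by split; move: e1 qe q2N; clear; lia.
have q1I : `|q1| <= 2 * N1%:Z - 2 by move: qU q_seam q_umb q1N; clear; lia.
have [e [e1 qe]] : exists e : int, `|e| = 1 /\ `|q2 - e| < 2 * N2%:Z.
  by case: (leP 0 q2) => sq; [exists 1|exists (-1)];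
    move: sq qU q1N q_seam N2_gt0; clear; lia.
exists (q1 - 1, q2 - e), (q1 + 1, q2 - e); rewrite !mem_around /=.
by split; move: e1 qe q1I; clear; lia.
Qed.

Lemma on_section_inj star eps s (q q' : idx) : eps \in signs ->
  on_section star eps s q -> on_section star eps s q' -> q.1 = q'.1 -> q = q'.
Proof.
case: q q' => [i j] [k l] /signsP eps1 /andP[_ /eqP /= ij] /andP[_ /eqP /= kl] ik.
by congr pair => //; case: eps1 ij kl => ->; rewrite ik; lia.
Qed.

(** Points of one section differ by at least 2 in the first double index, hence
    by at least 4 in the coordinate that varies along the section. *)
Lemma on_section_step star eps s (q q' : idx) : eps \in signs ->
  on_section star eps s q -> on_section star eps s q' -> q.1 < q'.1 ->
  q.1 - eps * q.2 + 4 <= q'.1 - eps * q'.2.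
Proof.
case: q q' => [i j] [k l] /signsP eps1 /andP[/and3P[/andP[/= ip _] _ _] /eqP /= ij].
move=> /andP[/and3P[/andP[/= kp _] _ _] /eqP /= kl] ik.
have ik2 : i + 2 <= k by move: ip kp ik; clear; case: star; lia.
by case: eps1 ij kl => ->; move: ik2; clear; lia.
Qed.

Lemma on_section_codiagonal star eps s (q : idx) : eps \in signs ->
  on_section star eps s q -> `|q.1 - eps * q.2| <= 2 * N1%:Z + 2 * N2%:Z.
Proof.
case: q => [i j] /signsP eps1 /andP[/and3P[_ /= iN jN] _].
by case: eps1 => ->; move: iN jN; clear; lia.
Qed.

End Lattice.

(** * The discrete ellipsoid *)

Section Ellipsoid.
Set Implicit Arguments.
Unset Strict Implicit.
Variables (R : realType) (N1 N2 : nat) (a b c f3 h3 g10 g20 : R)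
  (g1p g1m g2 : int -> R).
Hypotheses (N1_gt0 : (0 < N1)%N) (N2_gt0 : (0 < N2)%N).
Hypotheses (lt_cb : c < b) (lt_ba : b < a).
Hypothesis closing :
  (a - 2 * b + c) / (a - c) =
    cos ((4 * N2%:R - 1) * pi / (4 * N1%:R + 4 * N2%:R - 2)) /
    cos (pi / (4 * N1%:R + 4 * N2%:R - 2)).
Hypotheses (f3_gt0 : 0 < f3) (h3_gt0 : 0 < h3).
Hypotheses (g1pP : g1_solution N1 N2 a b c g10 g1p)
  (g1mP : g1_solution N1 N2 a b c (- g10) g1m)
  (g2P : g2_solution N1 N2 a b c g20 g2).

Local Notation angle := (@lattice_angle R N1 N2).
Local Notation quarter := (quarter_turn N1 N2).
Local Notation A := (@amplitude R N1 N2 a c).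
Local Notation f1 := (@f1 R N1 N2 a c).
Local Notation h1 := (@h1 R N1 N2 a c).
Local Notation f2 := (@f2 R N1 N2 a c).
Local Notation h2 := (@h2 R N1 N2 a c).

Lemma lt_ca : c < a. Proof. exact: lt_trans lt_cb lt_ba. Qed.

Lemma delta_half : delta R N1 N2 / 2 = angle 1.
Proof. by rewrite /lattice_angle /Defs.half; field. Qed.

Lemma amplitude_gt0 : 0 < A.
Proof.
rewrite sqrtr_gt0 delta_half divr_gt0 ?subr_gt0 ?lt_ca //.
exact: cos_angle1_gt0.
Qed.

Lemma amplitude_cos : A ^+ 2 * cos (angle 1) = a - c.
Proof.
have cos1 := cos_angle1_gt0 R N1_gt0 N2_gt0.
rewrite /amplitude delta_half sqr_sqrtr ?divfK ?gt_eqF //.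
by rewrite divr_ge0 ?subr_ge0 ?(ltW lt_ca) // ltW.
Qed.

Lemma cos_angle_adj (i j : int) : `|i - j| = 1 -> cos (angle (i - j)) = cos (angle 1).
Proof.
move=> ij; have [->//|->] : i - j = 1 \/ i - j = - 1 by lia.
by rewrite angleN cosN.
Qed.

Lemma f1h1_adj (i j : int) : `|i - j| = 1 -> f1 i * f1 j + h1 i * h1 j = a - c.
Proof.
move=> ij; rewrite -amplitude_cos -(cos_angle_adj ij) angleB cosB.
rewrite /Defs.f1 /Defs.h1 -!/(angle _); ring.
Qed.

Lemma f2h2_adj (i j : int) : `|i - j| = 1 -> f2 i * f2 j + h2 i * h2 j = a - c.
Proof.
move=> ij; rewrite -amplitude_cos -(cos_angle_adj ij) angleB cosB.
rewrite /Defs.f2 /Defs.h2 -!/(angle _); ring.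
Qed.

Lemma sin_angle_N1 : sin (angle (2 * N1%:Z)) = cos (angle (2 * N2%:Z - 1)).
Proof.
rewrite (_ : 2 * N1%:Z = quarter - (2 * N2%:Z - 1)); last by rewrite /quarter_turn; ring.
by rewrite angleB angle_quarter // sinB sin_pihalf cos_pihalf; ring.
Qed.

Lemma cos_angle_N1 : cos (angle (2 * N1%:Z)) = sin (angle (2 * N2%:Z - 1)).
Proof.
rewrite (_ : 2 * N1%:Z = quarter - (2 * N2%:Z - 1)); last by rewrite /quarter_turn; ring.
by rewrite angleB angle_quarter // cosB sin_pihalf cos_pihalf; ring.
Qed.

Lemma closing_angle : a - 2 * b + c = A ^+ 2 * cos (angle (4 * N2%:Z - 1)).
Proof.
have ac : a - c != 0 by rewrite subr_eq0 gt_eqF // lt_ca.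
have cos1 := cos_angle1_gt0 R N1_gt0 N2_gt0.
have q0 : (2 * N1%:R + 2 * N2%:R - 1 : R) != 0.
  have : (1 <= N1%:R :> R) by rewrite (ler_nat _ 1).
  have : (1 <= N2%:R :> R) by rewrite (ler_nat _ 1).
  by move=> ? ?; apply/negP => /eqP; lra.
have q0' : (4 * N1%:R + 4 * N2%:R - 2 : R) != 0.
  have -> : (4 * N1%:R + 4 * N2%:R - 2 : R) = 2 * (2 * N1%:R + 2 * N2%:R - 1) by ring.
  by rewrite mulf_eq0 negb_or q0 andbT.
have := closing.
have -> : (4 * N2%:R - 1) * pi / (4 * N1%:R + 4 * N2%:R - 2) = angle (4 * N2%:Z - 1).
  by rewrite /lattice_angle /Defs.half /delta intrB intrM; field; rewrite q0 q0'.
have -> : pi / (4 * N1%:R + 4 * N2%:R - 2) = angle 1.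
  by rewrite /lattice_angle /Defs.half /delta; field; rewrite q0 q0'.
move=> /(congr1 (fun x => x * (a - c))); rewrite divfK // => ->.
by rewrite -amplitude_cos; field; rewrite gt_eqF.
Qed.

(** Together with [bc_angle], the condition on a, b, c in the form in which it is
    used: f_1 f_2 = a - b and h_1 h_2 = b - c at the corner (N_1, N_2). *)
Lemma ab_angle :
  a - b = A ^+ 2 * (sin (angle (2 * N1%:Z)) * cos (angle (2 * N2%:Z))).
Proof.
have -> : a - b = (a - c + (a - 2 * b + c)) / 2 by field.
rewrite closing_angle -amplitude_cos sin_angle_N1.
have -> : angle 1 = angle (2 * N2%:Z) - angle (2 * N2%:Z - 1).
  by rewrite -angleB; congr angle; ring.
have -> : angle (4 * N2%:Z - 1) = angle (2 * N2%:Z) + angle (2 * N2%:Z - 1).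
  by rewrite -angleD; congr angle; ring.
by rewrite cosB cosD; field.
Qed.

Lemma bc_angle :
  b - c = A ^+ 2 * (cos (angle (2 * N1%:Z)) * sin (angle (2 * N2%:Z))).
Proof.
have -> : b - c = (a - c - (a - 2 * b + c)) / 2 by field.
rewrite closing_angle -amplitude_cos cos_angle_N1.
have -> : angle 1 = angle (2 * N2%:Z) - angle (2 * N2%:Z - 1).
  by rewrite -angleB; congr angle; ring.
have -> : angle (4 * N2%:Z - 1) = angle (2 * N2%:Z) + angle (2 * N2%:Z - 1).
  by rewrite -angleD; congr angle; ring.
by rewrite cosB cosD; field.
Qed.

(** The right-hand side of both recurrences after the products of sines and of
    cosines are turned into sums; [n] stands for N_1 or N_2.  In this form its
    zeros are visible. *)
Definition g_rhs (n m : int) : R :=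
  A ^+ 2 / 2 * (cos (angle (2 * m + 1)) - cos (angle (4 * n - 1))).

Lemma g1_rhs m : a - b - f1 m * f1 (m + 1) = g_rhs N1%:Z m.
Proof.
have -> : a - b = (a - c + (a - 2 * b + c)) / 2 by field.
have angle_N1 : angle (4 * N1%:Z - 1) = pi - angle (4 * N2%:Z - 1).
  rewrite (_ : 4 * N1%:Z - 1 = quarter + quarter - (4 * N2%:Z - 1)).
    by rewrite angleB angleD angle_quarter // -splitr.
  by rewrite /quarter_turn; ring.
rewrite /g_rhs angle_N1 cosB cospi sinpi.
rewrite closing_angle -amplitude_cos.
have -> : angle 1 = angle (m + 1) - angle m by rewrite -angleB; congr angle; ring.
have -> : angle (2 * m + 1) = angle (m + 1) + angle m.
  by rewrite -angleD; congr angle; ring.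
rewrite cosB cosD /Defs.f1 -!/(angle _).
by field.
Qed.

Lemma g2_rhs m : f2 m * f2 (m + 1) - a + b = g_rhs N2%:Z m.
Proof.
have -> : f2 m * f2 (m + 1) - a + b =
  f2 m * f2 (m + 1) - (a - c + (a - 2 * b + c)) / 2 by field.
rewrite /g_rhs closing_angle -amplitude_cos.
have -> : angle 1 = angle (m + 1) - angle m by rewrite -angleB; congr angle; ring.
have -> : angle (2 * m + 1) = angle (m + 1) + angle m.
  by rewrite -angleD; congr angle; ring.
rewrite cosB cosD /Defs.f2 -!/(angle _).
by field.
Qed.

Lemma g_rhs_first n : g_rhs n (- (2 * n)) = 0.
Proof.
rewrite /g_rhs (_ : 2 * (- (2 * n)) + 1 = - (4 * n - 1)); last by ring.
by rewrite angleN cosN subrr mulr0.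
Qed.

Lemma g_rhs_last n : g_rhs n (2 * n - 1) = 0.
Proof.
rewrite /g_rhs (_ : 2 * (2 * n - 1) + 1 = 4 * n - 1); last by ring.
by rewrite subrr mulr0.
Qed.

Lemma g_rhs_neq0 (n m : int) : 4 * n - 1 <= 2 * quarter ->
  - (2 * n) < m < 2 * n - 1 -> g_rhs n m != 0.
Proof.
move=> nq mn; rewrite /g_rhs mulf_neq0 //.
  by rewrite mulf_neq0 ?expf_neq0 ?gt_eqF ?amplitude_gt0 // invr_gt0.
rewrite subr_eq0 gt_eqF //; apply: angle_cos_lt => //; lia.
Qed.

Let N1_quarter : 4 * N1%:Z - 1 <= 2 * quarter.
Proof. by rewrite /quarter_turn; lia. Qed.
Let N2_quarter : 4 * N2%:Z - 1 <= 2 * quarter.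
Proof. by rewrite /quarter_turn; lia. Qed.

Let g1p_sol : product_solution (2 * N1%:Z) (g_rhs N1%:Z) g1p.
Proof. by move=> m /g1pP.2; rewrite g1_rhs. Qed.
Let g1m_sol : product_solution (2 * N1%:Z) (g_rhs N1%:Z) g1m.
Proof. by move=> m /g1mP.2; rewrite g1_rhs. Qed.
Let g2_sol : product_solution (2 * N2%:Z) (g_rhs N2%:Z) g2.
Proof. by move=> m /g2P.2; rewrite g2_rhs. Qed.

Lemma g1p_eq0 (m : int) : `|m| <= 2 * N1%:Z -> (g1p m == 0) = (`|m| == 2 * N1%:Z).
Proof.
apply: product_solution_eq0 g1p_sol; first by lia.
- exact: g_rhs_first.
- exact: g_rhs_last.
by move=> k; exact: g_rhs_neq0.
Qed.

Lemma g2_eq0 (m : int) : `|m| <= 2 * N2%:Z -> (g2 m == 0) = (`|m| == 2 * N2%:Z).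
Proof.
apply: product_solution_eq0 g2_sol; first by lia.
- exact: g_rhs_first.
- exact: g_rhs_last.
by move=> k; exact: g_rhs_neq0.
Qed.

Lemma g1m_opp (m : int) : `|m| <= 2 * N1%:Z -> g1m m = - g1p m.
Proof.
apply: product_solution_opp g1p_sol g1m_sol _ _; first by lia.
- exact: g_rhs_first.
- exact: g_rhs_last.
- by move=> k; exact: g_rhs_neq0.
by rewrite g1pP.1 g1mP.1.
Qed.

Lemma g1_adj (i j : int) : `|i - j| = 1 -> `|i| <= 2 * N1%:Z -> `|j| <= 2 * N1%:Z ->
  g1p i * g1p j = a - b - f1 i * f1 j.
Proof.
move=> ij iN jN; have [E|E] : i = j + 1 \/ j = i + 1 by lia.
  by rewrite E g1pP.2 ?[f1 j * _]mulrC //; lia.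
by rewrite E mulrC g1pP.2 //; lia.
Qed.

Lemma g2_adj (i j : int) : `|i - j| = 1 -> `|i| <= 2 * N2%:Z -> `|j| <= 2 * N2%:Z ->
  g2 i * g2 j = f2 i * f2 j - a + b.
Proof.
move=> ij iN jN; have [E|E] : i = j + 1 \/ j = i + 1 by lia.
  by rewrite E g2P.2 ?[f2 j * _]mulrC //; lia.
by rewrite E mulrC g2P.2 //; lia.
Qed.

Local Notation K1 := (Num.sqrt ((a - b) * (a - c))).
Local Notation K2 := (Num.sqrt ((a - b) * (b - c))).
Local Notation K3 := (Num.sqrt ((a - c) * (b - c))).
Local Notation X := (ellipsoid N1 N2 a b c f3 h3 g1p g1m g2).

Lemma K1_gt0 : 0 < K1.
Proof. by rewrite sqrtr_gt0 mulr_gt0 ?subr_gt0 ?lt_ca. Qed.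
Lemma K2_gt0 : 0 < K2.
Proof. by rewrite sqrtr_gt0 mulr_gt0 ?subr_gt0. Qed.
Lemma K3_gt0 : 0 < K3.
Proof. by rewrite sqrtr_gt0 mulr_gt0 ?subr_gt0 ?lt_ca. Qed.

Lemma K1_sqr : K1 ^+ 2 = (a - b) * (a - c).
Proof. by rewrite sqr_sqrtr // mulr_ge0 ?subr_ge0 ?ltW ?lt_ca. Qed.
Lemma K2_sqr : K2 ^+ 2 = (a - b) * (b - c).
Proof. by rewrite sqr_sqrtr // mulr_ge0 ?subr_ge0 ?ltW ?lt_ca. Qed.
Lemma K3_sqr : K3 ^+ 2 = (a - c) * (b - c).
Proof. by rewrite sqr_sqrtr // mulr_ge0 ?subr_ge0 ?ltW ?lt_ca. Qed.

Lemma point3_eta (v : 'rV[R]_3) : v = point3 (v 0 0) (v 0 1) (v 0 2%:R).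
Proof.
by apply/rowP => i; rewrite mxE; case: i => [[|[|[|]]]] //= ?;
  congr (v _ _); apply/val_inj.
Qed.

Definition ff (q : idx) : R := f1 q.1 * f2 q.2.
Definition gg (q : idx) : R := g1p q.1 * g2 q.2.
Definition hh (q : idx) : R := h1 q.1 * h2 q.2.

(** The points of r^+ for [sg = 1] and of r^- for [sg = -1]. *)
Definition sheet_point (sg : R) (q : idx) : 'rV[R]_3 :=
  point3 (ff q * f3 / K1) (sg * gg q / K2) (hh q * h3 / K3).

(** The vector dual to [sheet_point sg q] for x^2/f_3^2 + y^2 + z^2/h_3^2: it has
    the same products F, G, H, with f_3 and h_3 inverted. *)
Definition pole (sg : R) (q : idx) : 'rV[R]_3 :=
  point3 (ff q / (f3 * K1)) (sg * gg q / K2) (hh q / (h3 * K3)).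

Lemma dot_point3 (x y z x' y' z' : R) :
  dot (point3 x y z) (point3 x' y' z') = x * x' + y * y' + z * z'.
Proof. by rewrite dotE !mxE. Qed.

Lemma gg_eq0 q : inbox N1 N2 q -> (gg q == 0) = ~~ off_seam N1 N2 q.
Proof.
by move=> /andP[q1 q2]; rewrite mulf_eq0 g1p_eq0 // g2_eq0 // /off_seam; lia.
Qed.

Lemma ellipsoid_front v : inbox N1 N2 v -> X v = sheet_point 1 v.
Proof.
case/andP=> v1 v2; rewrite /ellipsoid (_ : v.1 <= 2 * N1%:Z); last by lia.
by rewrite /semi_ellipsoid /sheet_point mul1r.
Qed.

(** The reflection fixes the indices with n_1 = N_1; there R is given by r^+, and
    the formula holds because g_1 vanishes. *)
Lemma ellipsoid_back v : inbox N1 N2 v -> X (mirror N1 v) = sheet_point (-1) v.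
Proof.
move=> v_box; have /andP[v1 v2] := v_box; rewrite /ellipsoid; case: ifPn => [mv|_].
  have E : mirror N1 v = v.
    by case: (v) mv v1 => u1 u2; rewrite /mirror /= => ? ?; congr pair; lia.
  have /eqP g0 : gg v == 0.
    rewrite gg_eq0 // /off_seam; move: mv v1; rewrite /mirror /=; lia.
  by rewrite E /semi_ellipsoid /sheet_point -/(gg v) g0 !(mul0r, mulr0).
by rewrite mirrorK /semi_ellipsoid /sheet_point g1m_opp // mulN1r mulNr.
Qed.

(** The conjugacy of neighbouring points.  With u = f_1 f_1' and v = f_2 f_2'
    the other products are affine in u or in v, and the coefficients of u v, u
    and v cancel. *)
Lemma pole_incidence sg q v : sg ^+ 2 = 1 -> inbox N1 N2 q -> inbox N1 N2 v ->
  v \in around q -> dot (sheet_point sg v) (pole sg q) = 1.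
Proof.
move=> sg2 /andP[q1 q2] /andP[v1 v2]; rewrite mem_around => /andP[/eqP vq1 /eqP vq2].
have := f1h1_adj vq1; have := f2h2_adj vq2.
have := g1_adj vq1 v1 q1; have := g2_adj vq2 v2 q2.
have k1 := K1_sqr; have k2 := K2_sqr; have k3 := K3_sqr.
have k1p := K1_gt0; have k2p := K2_gt0; have k3p := K3_gt0.
rewrite dot_point3 => Eg2 Eg1 Ef2 Ef1.
have -> : ff v * f3 / K1 * (ff q / (f3 * K1)) =
    (f1 v.1 * f1 q.1) * (f2 v.2 * f2 q.2) / K1 ^+ 2.
  by rewrite /ff; field; rewrite !gt_eqF.
have -> : sg * gg v / K2 * (sg * gg q / K2) =
    sg ^+ 2 * ((g1p v.1 * g1p q.1) * (g2 v.2 * g2 q.2)) / K2 ^+ 2.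
  by rewrite /gg; field; rewrite !gt_eqF.
have -> : hh v * h3 / K3 * (hh q / (h3 * K3)) =
    (h1 v.1 * h1 q.1) * (h2 v.2 * h2 q.2) / K3 ^+ 2.
  by rewrite /hh; field; rewrite !gt_eqF.
rewrite Eg1 Eg2 sg2 k1 k2 k3.
rewrite (_ : h1 v.1 * h1 q.1 = a - c - f1 v.1 * f1 q.1); last by rewrite -Ef1; ring.
rewrite (_ : h2 v.2 * h2 q.2 = a - c - f2 v.2 * f2 q.2); last by rewrite -Ef2; ring.
field; rewrite !subr_eq0 !gt_eqF ?lt_ca //.
Qed.

(** Polar planes of boundary points are symmetric about y = 0. *)
Lemma pole_boundary sg sg' q : inbox N1 N2 q -> ~~ off_seam N1 N2 q ->
  pole sg q = pole sg' q.
Proof. by move=> q_box; rewrite -gg_eq0 // /pole => /eqP ->; rewrite !mulr0. Qed.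

(** The linear form whose value at a point of either semi-ellipsoid is F + t H;
    it does not see y. *)
Definition diagonal_form (t : int) : 'rV[R]_3 :=
  point3 (K1 / f3) 0 (t%:~R * K3 / h3).

Lemma ff_hh t q : t \in signs ->
  ff q + t%:~R * hh q = A ^+ 2 * sin (angle (q.1 + t * q.2)).
Proof.
rewrite /ff /hh /Defs.f1 /Defs.f2 /Defs.h1 /Defs.h2 -!/(angle _).
case/signsP=> ->; first by rewrite !mul1r angleD sinD; ring.
by rewrite !mulN1r angleB sinB; ring.
Qed.

Lemma diagonal_formE sg t q : t \in signs ->
  dot (sheet_point sg q) (diagonal_form t) = A ^+ 2 * sin (angle (q.1 + t * q.2)).
Proof.
move=> t1; rewrite -ff_hh // dot_point3 mulr0 addr0.
have k1p := K1_gt0; have k3p := K3_gt0.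
by field; rewrite !gt_eqF.
Qed.

Lemma diagonal_form_neq sg sg' t q v : t \in signs ->
  let i := q.1 + t * q.2 in let j := v.1 + t * v.2 in
  i < j -> `|i + j| < 2 * quarter -> j - i < 4 * quarter ->
  dot (sheet_point sg q) (diagonal_form t) !=
  dot (sheet_point sg' v) (diagonal_form t).
Proof.
move=> t1 i j ij iDj jBi; rewrite !diagonal_formE // lt_eqF //.
by rewrite ltr_pM2l ?exprn_gt0 ?amplitude_gt0 ?angle_sin_lt.
Qed.

(** Incidences put the dual face inside a plane; a triangle in it makes the two
    equal. *)
Lemma box_polar m u v1 v2 v3 n :
  (forall w, w \in dual_face N1 N2 m -> dot (X w) u = 1) ->
  {subset [:: v1; v2; v3] <= dual_face N1 N2 m} ->
  dot (X v2) n = dot (X v3) n -> dot (X v1) n != dot (X v2) n ->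
  X v2 != X v3 -> box N1 N2 X m = polar_plane u.
Proof.
move=> inc sub e23 e12 n23; rewrite /box /proj_span.
rewrite (map_comp (@homog R)); apply: span_homog_polar e23 e12 n23.
  by move=> _ /mapP[w /inc wu ->].
move=> t; rewrite !inE => /or3P[] /eqP ->; apply/map_f/sub; rewrite !inE eqxx ?orbT //.
Qed.

Lemma front_incidence star q w : inU N1 N2 star q -> w \in dual_face N1 N2 q ->
  dot (X w) (pole 1 q) = 1.
Proof.
move=> qU /(dual_face_front N1_gt0 N2_gt0 qU)[wq w_box w_seam].
have q_box : inbox N1 N2 q by apply: inU_inbox qU.
move: wq w_box; rewrite /front_index; case: ifPn => w1 wq w_box.
  by rewrite ellipsoid_front // pole_incidence ?expr1n.
rewrite -(mirrorK N1 w) ellipsoid_back // (pole_boundary 1 (-1) q_box).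
  by rewrite pole_incidence ?sqrrN ?expr1n.
by apply: w_seam; lia.
Qed.

Lemma back_incidence q w : off_seam N1 N2 q ->
  w \in dual_face N1 N2 (mirror N1 q) -> dot (X w) (pole (-1) q) = 1.
Proof.
move=> q_off /(dual_face_back N1_gt0 N2_gt0 q_off)/andP[wq w_box].
rewrite -(mirrorK N1 w) ellipsoid_back // pole_incidence ?sqrrN ?expr1n //.
by move: q_off; rewrite /off_seam /inbox; lia.
Qed.

(** Two opposite neighbours agree in F + H and differ in F - H; a third one
    differs in F + H.  The third is taken towards the centre: at a corner of U^* the
    outward neighbour has the same F + H as the corner itself, by the symmetry of
    the sine about the quarter turn. *)
Lemma around_triangle q : off_seam N1 N2 q ->
  exists v1 v2 v3 : idx, [/\ {subset [:: v1; v2; v3] <= around q},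
    all (inbox N1 N2) [:: v1; v2; v3] &
    forall sg, [/\
      dot (sheet_point sg v2) (diagonal_form 1) =
        dot (sheet_point sg v3) (diagonal_form 1),
      dot (sheet_point sg v1) (diagonal_form 1) !=
        dot (sheet_point sg v2) (diagonal_form 1) &
      sheet_point sg v2 != sheet_point sg v3]].
Proof.
move=> q_off; pose e : int := if q.1 + q.2 < 0 then -1 else 1.
have e1 : e = 1 /\ 0 <= q.1 + q.2 \/ e = -1 /\ q.1 + q.2 < 0.
  by rewrite /e; case: ltP => ?; [right|left].
have [] := andP q_off => q1 q2.
exists (q.1 - e, q.2 - e), (q.1 - 1, q.2 + 1), (q.1 + 1, q.2 - 1); split.
- by move=> v; rewrite mem_around !inE => /or3P[] /eqP -> /=; lia.
- by rewrite /= /inbox /=; lia.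
move=> sg; split.
- by rewrite !diagonal_formE //=; congr (_ * sin (angle _)); ring.
- case: e1 => [] [-> q12].
    by apply: diagonal_form_neq => //=; rewrite /quarter_turn; lia.
  by rewrite eq_sym; apply: diagonal_form_neq => //=; rewrite /quarter_turn; lia.
apply: contra_neq (_ : dot (sheet_point sg (q.1 - 1, q.2 + 1)) (diagonal_form (-1)) !=
                     dot (sheet_point sg (q.1 + 1, q.2 - 1)) (diagonal_form (-1))).
  by move=> ->.
by apply: diagonal_form_neq => //=; rewrite /quarter_turn; lia.
Qed.

Lemma box_back star q : inU N1 N2 star q -> off_seam N1 N2 q ->
  box N1 N2 X (mirror N1 q) = polar_plane (pole (-1) q).
Proof.
move=> qU q_off.
have [v1 [v2 [v3 [sub /and4P[b1 b2 b3 _] /(_ (-1))[e23 e12 n23]]]]] :=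
  around_triangle q_off.
rewrite -!ellipsoid_back // in e23 e12 n23.
apply: (box_polar (v1 := mirror N1 v1) _ _ e23 e12 n23) => [w|w].
  exact: back_incidence q_off.
rewrite -[[:: _; _; _]]/(map (mirror N1) [:: v1; v2; v3]) => /mapP[v /sub vq ->].
exact: (around_off_seam N1_gt0 N2_gt0 qU q_off vq).2.
Qed.

Lemma box_front_off_seam star q : inU N1 N2 star q -> off_seam N1 N2 q ->
  box N1 N2 X q = polar_plane (pole 1 q).
Proof.
move=> qU q_off.
have [v1 [v2 [v3 [sub /and4P[b1 b2 b3 _] /(_ 1)[e23 e12 n23]]]]] :=
  around_triangle q_off.
rewrite -!ellipsoid_front // in e23 e12 n23.
apply: (box_polar (v1 := v1) _ _ e23 e12 n23) => [w|w].
  exact: front_incidence qU.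
by move=> /sub wq; exact: (around_off_seam N1_gt0 N2_gt0 qU q_off wq).1.
Qed.

Lemma sheet_point_opp_neq q : off_seam N1 N2 q -> sheet_point 1 q != sheet_point (-1) q.
Proof.
move=> q_off; have := gg_eq0 (off_seam_inbox N1_gt0 N2_gt0 q_off).
rewrite q_off => /negbT g0.
apply/eqP => /(congr1 (fun v => dot v (point3 0 K2 0))) /=; rewrite !dot_point3 !mulr0.
have k2 := K2_gt0; rewrite !addr0 !add0r !divfK ?gt_eqF // mul1r mulN1r => E.
by move/eqP: g0; apply; lra.
Qed.

Lemma off_seam_sum (v v' : idx) : off_seam N1 N2 v -> off_seam N1 N2 v' ->
  `|v'.1 + v'.2 + (v.1 + v.2)| < 2 * quarter.
Proof.
case: v v' => [i j] [k l] /andP[/= iN jN] /andP[/= kN lN].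
have ijkl : `|k + l + (i + j)| <= `|k| + `|l| + (`|i| + `|j|).
  by rewrite (le_trans (ler_normD _ _)) // lerD ?ler_normD.
by rewrite /quarter_turn; move: iN jN kN lN ijkl; clear; lia.
Qed.

(** Two neighbours and the mirror image of one of them form the triangle: F + H
    separates the two neighbours, and the y-coordinate separates a neighbour
    from its mirror image. *)
Lemma box_front_seam star q : inU N1 N2 star q -> ~~ off_seam N1 N2 q ->
  q \notin umbilic_vertices N1 N2 -> box N1 N2 X q = polar_plane (pole 1 q).
Proof.
move=> qU q_seam q_umb.
have [v [v' [vq v'q v_off v'_off vv']]] :=
  seam_neighbours N1_gt0 N2_gt0 qU q_seam q_umb.
have v_box := off_seam_inbox N1_gt0 N2_gt0 v_off.
have v'_box := off_seam_inbox N1_gt0 N2_gt0 v'_off.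
have [vD v'D] := around_boundary N1_gt0 N2_gt0 qU q_seam vq v_off.
have [v'F _] := around_boundary N1_gt0 N2_gt0 qU q_seam v'q v'_off.
apply: (@box_polar q (pole 1 q) v' v (mirror N1 v) (diagonal_form 1)).
- by move=> w; exact: front_incidence qU.
- by move=> w; rewrite !inE => /or3P[] /eqP ->.
- by rewrite ellipsoid_front // ellipsoid_back // !diagonal_formE.
- rewrite !ellipsoid_front // eq_sym; apply: diagonal_form_neq => //; rewrite !mul1r.
  + by rewrite vv' ltrDl.
  + by rewrite addrC; exact: off_seam_sum.
  + rewrite vv' addrAC subrr add0r.
    by rewrite /quarter_turn; move: N1_gt0 N2_gt0; clear; lia.
by rewrite ellipsoid_front // ellipsoid_back // sheet_point_opp_neq.
Qed.

Lemma box_front star q : inU N1 N2 star q -> q \notin umbilic_vertices N1 N2 ->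
  box N1 N2 X q = polar_plane (pole 1 q).
Proof.
move=> qU q_umb; have [q_off|q_seam] := boolP (off_seam N1 N2 q).
  exact: box_front_off_seam qU q_off.
exact: box_front_seam qU q_seam q_umb.
Qed.

Lemma box_section star eps s m : eps \in signs ->
  m \in with_plane N1 N2 (cross_section N1 N2 star eps s) ->
  exists q sg, on_section N1 N2 star eps s q /\
    box N1 N2 X m = polar_plane (pole sg q).
Proof.
move=> eps1; rewrite mem_filter => /andP[m_umb].
move=> /(mem_cross_section N1_gt0 N2_gt0 eps1)[q q_on].
have /andP[qU _] := q_on.
case=> [mq|[-> q_off]]; [exists q, 1|exists q, (-1)]; split=> //.
  by rewrite mq; apply: box_front qU _; rewrite -mq.
exact: box_back qU q_off.
Qed.

(** The common point of the planes along the section with parameter [s]. *)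
Definition apex (eps s : int) : 'rV[R]_4 :=
  proj_point (A ^+ 2 * sin (angle (2 * s)))
    (point3 (f3 * K1) 0 (eps%:~R * h3 * K3)).

Lemma apex_polar star eps s sg q : eps \in signs -> on_section N1 N2 star eps s q ->
  apex eps s \in polar_plane (pole sg q).
Proof.
move=> eps1 /andP[_ /eqP qs]; rewrite mem_polar_plane space_part_point weight_point.
rewrite -qs -ff_hh // dot_point3 mul0r addr0; apply/eqP.
have k1p := K1_gt0; have k3p := K3_gt0.
by field; rewrite !gt_eqF.
Qed.

Lemma apex_neq0 eps s : apex eps s != 0.
Proof.
rewrite proj_point_eq0 negb_and; apply/orP; right.
apply/eqP => /rowP/(_ 0); rewrite !mxE /= => /eqP.
by rewrite mulf_eq0 !gt_eqF ?K1_gt0.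
Qed.

Lemma apex_finite star eps s q : eps \in signs -> on_section N1 N2 star eps s q ->
  s != 0 -> apex eps s 0 0 != 0.
Proof.
move=> eps1 /(on_section_bound N1_gt0 N2_gt0 eps1) s_bound s0.
rewrite -/(weight _) weight_point; apply: mulf_neq0.
  by rewrite expf_neq0 // gt_eqF // amplitude_gt0.
have {}s_bound : `|s| <= N1%:Z + N2%:Z by move: s_bound; clear; lia.
have angle0 : angle 0 = 0 by rewrite angleE mul0r.
have [s_gt|s_lt|/esym/eqP] := ltgtP 0 s; last by rewrite (negPf s0).
  rewrite gt_eqF // -sin0 -angle0 angle_sin_lt //; rewrite /quarter_turn;
  by move: s_bound s_gt N1_gt0 N2_gt0; clear; lia.
rewrite lt_eqF // -sin0 -angle0 angle_sin_lt //; rewrite /quarter_turn;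
by move: s_bound s_lt N1_gt0 N2_gt0; clear; lia.
Qed.

Lemma umbilic_inbox t t' : t \in signs -> t' \in signs ->
  inbox N1 N2 (umbilic_vertex N1 N2 t t').
Proof.
by move=> /signsP[] -> /signsP[] ->; rewrite /inbox /umbilic_vertex /=; clear; lia.
Qed.

Lemma ellipsoid_umbilic t t' : t \in signs -> t' \in signs ->
  X (umbilic_vertex N1 N2 t t') =
  point3 (t%:~R * (a - b) * f3 / K1) 0 (t'%:~R * (b - c) * h3 / K3).
Proof.
move=> t1 t'1; have u_box := umbilic_inbox t1 t'1; rewrite ellipsoid_front // /sheet_point.
have /eqP -> : gg (umbilic_vertex N1 N2 t t') == 0.
  rewrite gg_eq0 // /off_seam /umbilic_vertex /=.
  by case/signsP: t1 => ->; clear; lia.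
have -> : ff (umbilic_vertex N1 N2 t t') = t%:~R * (a - b).
  rewrite ab_angle /ff /Defs.f1 /Defs.f2 -!/(angle _) /umbilic_vertex /=.
  by case/signsP: t1 => ->; case/signsP: t'1 => ->;
    rewrite ?mul1r ?mulN1r ?angleN ?sinN ?cosN; ring.
have -> : hh (umbilic_vertex N1 N2 t t') = t'%:~R * (b - c).
  rewrite bc_angle /hh /Defs.h1 /Defs.h2 -!/(angle _) /umbilic_vertex /=.
  by case/signsP: t1 => ->; case/signsP: t'1 => ->;
    rewrite ?mul1r ?mulN1r ?angleN ?sinN ?cosN; ring.
by rewrite mulr0 mul0r.
Qed.

(** Opposite umbilic vertices are V and - V, so that their line consists of the
    points (w, t V); the apex has t = a - c. *)
Lemma apex_umbilic_line eps s : eps \in signs ->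
  apex eps s \in umbilic_line N1 N2 X 1 eps.
Proof.
move=> eps1; have epsN1 : - eps \in signs by case/signsP: eps1 => ->.
rewrite /umbilic_line /proj_span /= span_cons span_seq1 !homogE !ellipsoid_umbilic //.
(* (w, t V) = (w + t) / 2 (1, V) + (w - t) / 2 (1, - V), here with t = a - c. *)
set V := point3 _ _ _; set V' := point3 _ _ _; pose w := A ^+ 2 * sin (angle (2 * s)).
have -> : apex eps s = ((w + (a - c)) / 2) *: proj_point 1 V
                     + ((w - (a - c)) / 2) *: proj_point 1 V'.
  rewrite !proj_pointZ proj_pointD; congr proj_point; first by rewrite /w; field.
  have k1 := K1_sqr; have k3 := K3_sqr; have k1p := K1_gt0; have k3p := K3_gt0.
  apply/rowP => i; rewrite !mxE; case: i => [[|[|[|]]]] //= _; last 1 first.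
  - have -> : eps%:~R * h3 * K3 = eps%:~R * h3 * K3 ^+ 2 / K3 by field; rewrite gt_eqF.
    by rewrite k3; field; rewrite gt_eqF.
  - have -> : f3 * K1 = f3 * K1 ^+ 2 / K1 by field; rewrite gt_eqF.
    by rewrite k1; field; rewrite gt_eqF.
  by rewrite !mulr0 addr0.
by apply: memv_add; apply: memvZ; rewrite memv_line.
Qed.

(** Along a section F + eps H is constant and F - eps H is injective.  The sum of
    two indices could reach twice the quarter turn only if both were close to the
    largest value, which the gap of 4 between them rules out. *)
Lemma section_separated star eps s sg sg' q q' : eps \in signs ->
  on_section N1 N2 star eps s q -> on_section N1 N2 star eps s q' -> q != q' ->
  dot (sheet_point sg q) (diagonal_form (- eps)) !=
  dot (sheet_point sg' q') (diagonal_form (- eps)).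
Proof.
move=> eps1; have epsN1 : - eps \in signs by case/signsP: eps1 => ->.
wlog: q q' sg sg' / q.1 < q'.1.
  move=> wlg q_on q'_on qq'; have [lt|gt|E] := ltgtP q.1 q'.1.
  - exact: wlg.
  - by rewrite eq_sym; apply: wlg => //; rewrite eq_sym.
  by case/eqP: qq'; exact: on_section_inj q_on q'_on E.
move=> lt_qq' q_on q'_on _.
have := on_section_step eps1 q_on q'_on lt_qq'.
have := on_section_codiagonal eps1 q_on; have := on_section_codiagonal eps1 q'_on.
rewrite -!mulNr.
set j : int := q'.1 + _; set i : int := q.1 + _ => jN iN ij.
apply: diagonal_form_neq => //.
- by change (i < j); move: ij; clear; lia.
- change (`|i + j| < 2 * quarter).
  by rewrite /quarter_turn; move: N1_gt0 N2_gt0 iN jN ij; clear; lia.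
change (j - i < 4 * quarter).
by rewrite /quarter_turn; move: N1_gt0 N2_gt0 iN jN ij; clear; lia.
Qed.

(** The first two planes give y = 0.  Subtracting the third one, the constancy of
    F + eps H forces x and z into the ratio that the apex has. *)
Lemma apex_unique star eps s sg q q' Q : eps \in signs ->
  on_section N1 N2 star eps s q -> on_section N1 N2 star eps s q' -> q != q' ->
  off_seam N1 N2 q -> Q \in polar_plane (pole 1 q) ->
  Q \in polar_plane (pole (-1) q) -> Q \in polar_plane (pole sg q') ->
  Q \in <[apex eps s]>%VS.
Proof.
move=> eps1 q_on q'_on qq' q_off.
have := section_separated 1 1 eps1 q_on q'_on qq'.
have epsN1 : - eps \in signs by case/signsP: eps1 => ->.
rewrite !diagonal_formE // -!ff_hh //.
have := ff_hh q eps1; have := ff_hh q' eps1.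
move: (q_on) (q'_on) => /andP[_ /eqP qs] /andP[_ /eqP q's].
rewrite qs q's; set W := A ^+ 2 * _ => W' Wq sep.
have := gg_eq0 (off_seam_inbox N1_gt0 N2_gt0 q_off); rewrite q_off => /negbT g0.
rewrite -(proj_pointK Q) !mem_polar_plane !space_part_point !weight_point.
set w := weight Q; rewrite (point3_eta (space_part Q)).
move: (space_part Q 0 0) (space_part Q 0 1) (space_part Q 0 2%:R) => x y z.
rewrite !dot_point3 => /eqP Q1 /eqP Q2.
have k1p := K1_gt0; have k2p := K2_gt0; have k3p := K3_gt0.
have y0 : y = 0.
  have /eqP : y * (gg q / K2) = 0 by move: Q1 Q2; rewrite !mul1r !mulN1r !mulNr !mulrN; lra.
  rewrite mulf_eq0 => /orP[/eqP //|].
  by rewrite mulf_eq0 (negPf g0) invr_eq0 gt_eqF.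
rewrite y0 !mul0r !addr0 in Q1 Q2 * => /eqP Q3.
pose x' := x / (f3 * K1); pose z' := z / (h3 * K3).
have xE : x = x' * (f3 * K1) by rewrite /x' divfK // mulf_neq0 ?gt_eqF.
have zE : z = z' * (h3 * K3) by rewrite /z' divfK // mulf_neq0 ?gt_eqF.
have {}Q1 : x' * ff q + z' * hh q = w by rewrite -Q1 /x' /z'; ring.
have {}Q3 : x' * ff q' + z' * hh q' = w by rewrite -Q3 /x' /z'; ring.
have fE : ff q = W - eps%:~R * hh q by rewrite -Wq addrK.
have fE' : ff q' = W - eps%:~R * hh q' by rewrite -W' addrK.
have h_neq : hh q - hh q' != 0.
  by apply: contraNneq sep => /subr0_eq hE; rewrite fE fE' hE.
have z'E : z' = eps%:~R * x'.
  apply/eqP; rewrite -subr_eq0; have /eqP : (z' - eps%:~R * x') * (hh q - hh q') = 0.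
    by move: Q1 Q3; rewrite fE fE' => <- ?; lra.
  by rewrite mulf_eq0 (negPf h_neq) orbF.
have -> : proj_point w (point3 x 0 z) = x' *: apex eps s.
  rewrite proj_pointZ; congr proj_point.
    by rewrite -Q1 fE z'E -/W; ring.
  apply/rowP => i; rewrite !mxE; case: i => [[|[|[|]]]] //= _.
  - by rewrite mulr0.
  by rewrite zE z'E; ring.
exact/memvZ/memv_line.
Qed.

Lemma section_points_distinct star eps s q q' : eps \in signs ->
  on_section N1 N2 star eps s q -> on_section N1 N2 star eps s q' -> q != q' ->
  forall sg sg', sheet_point sg q != sheet_point sg' q'.
Proof.
move=> eps1 q_on q'_on qq' sg sg'.
have := section_separated sg sg' eps1 q_on q'_on qq'.
by apply: contraNneq => ->.
Qed.

Lemma star_off_seam q : inU N1 N2 true q -> off_seam N1 N2 q.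
Proof. by rewrite /inU /off_seam; move: N1_gt0 N2_gt0; clear; lia. Qed.

Lemma cross_section_collapse star eps C : eps \in signs ->
  C \in cross_sections N1 N2 star eps ->
  (C \in ends (cross_sections N1 N2 star eps)) =
    (size (undup [seq X m | m <- C]) == if star then 2%N else 1%N).
Proof.
move=> eps1; rewrite mem_filter => /andP[C0 /mapP[s _ CE]].
have [C_end|C_nend] := boolP (C \in _); apply/esym.
  move: C_end; rewrite cross_sections_ends // => C_end.
  have {C_end CE} [t t1 ->] : exists2 t, t \in signs & C = end_section N1 N2 star eps t.
    by move: C_end; rewrite !inE => /orP[]/eqP ->; [exists (-1)|exists 1].
  rewrite /end_section; case: star => //.
  have p_on := on_section_end N1_gt0 N2_gt0 true (end_point N1 N2 true eps t) eps1 t1.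
  move: p_on; rewrite eqxx => /andP[pU _]; have p_off := star_off_seam pU.
  have p_box := off_seam_inbox N1_gt0 N2_gt0 p_off.
  rewrite /= (ellipsoid_front p_box) (ellipsoid_back p_box) inE.
  by rewrite (negPf (sheet_point_opp_neq p_off)).
move: C0 C_nend; rewrite CE => C0 C_nend.
have [q [q' [qq' q_on q'_on]]] := section_two_points N1_gt0 N2_gt0 eps1 C0 C_nend.
have qC := on_section_mem N1_gt0 N2_gt0 eps1 q_on.
have q'C := on_section_mem N1_gt0 N2_gt0 eps1 q'_on.
have /andP[qU _] := q_on; have /andP[q'U _] := q'_on.
have q_box := inU_inbox N1_gt0 N2_gt0 qU; have q'_box := inU_inbox N1_gt0 N2_gt0 q'U.
have neq := section_points_distinct eps1 q_on q'_on qq'.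
apply/negbTE; rewrite neq_ltn; apply/orP; right.
case: star CE C0 C_nend q_on q'_on qC q'C qU q'U neq =>
    CE C0 C_nend q_on q'_on qC q'C qU q'U neq; last first.
  apply: (@uniq_leq_size _ [:: X q; X q']).
    by rewrite /= inE (ellipsoid_front q_box) (ellipsoid_front q'_box) neq.
  by move=> v; rewrite !inE mem_undup => /orP[] /eqP ->; exact: map_f.
have q_off := star_off_seam qU.
have mqC := on_section_mem_mirror N1_gt0 N2_gt0 eps1 q_on.
apply: (@uniq_leq_size _ [:: X q; X (mirror N1 q); X q']).
  rewrite /= !inE (ellipsoid_front q_box) (ellipsoid_front q'_box).
  by rewrite (ellipsoid_back q_box) negb_or !neq sheet_point_opp_neq.
by move=> v; rewrite !inE mem_undup => /or3P[] /eqP ->; exact: map_f.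
Qed.

Lemma section_planes star eps s : eps \in signs ->
  let C := cross_section N1 N2 star eps s in
  C != [::] ->
  (forall m, m \in with_plane N1 N2 C -> \dim (box N1 N2 X m) = 3%N) /\
  exists P : 'rV[R]_4,
    [/\ P != 0, s != 0 -> P 0 0 != 0,
      exists2 t : int, t \in signs & P \in umbilic_line N1 N2 X 1 t,
      forall m, m \in with_plane N1 N2 C -> P \in box N1 N2 X m
    & (2 < size (with_plane N1 N2 C))%N -> forall Q : 'rV[R]_4,
        (forall m, m \in with_plane N1 N2 C -> Q \in box N1 N2 X m) ->
        Q \in <[P]>%VS].
Proof.
move=> eps1 C C0; split=> [m mC|].
  by have [q [sg [_ ->]]] := box_section eps1 mC; rewrite dim_polar_plane.
have [q0 q0_on] := section_neq0 N1_gt0 N2_gt0 eps1 C0.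
exists (apex eps s); split.
- exact: apex_neq0.
- exact: apex_finite eps1 q0_on.
- by exists eps; last exact: apex_umbilic_line.
- move=> m mC; have [q [sg [q_on ->]]] := box_section eps1 mC.
  exact: apex_polar eps1 q_on.
move=> C_large Q QC.
have [q [q' [q_on q'_on qq' [q_off qC mqC q'C]]]] :=
  large_section N1_gt0 N2_gt0 eps1 C_large.
have /andP[qU _] := q_on; have /andP[q'U _] := q'_on.
have umb m : m \in with_plane N1 N2 C -> m \notin umbilic_vertices N1 N2.
  by rewrite mem_filter => /andP[].
have := QC _ qC; have := QC _ mqC; have := QC _ q'C.
rewrite (box_front qU (umb _ qC)) (box_front q'U (umb _ q'C)) (box_back qU q_off).
by move=> Q3 Q2 Q1; exact: apex_unique q_on q'_on qq' q_off Q1 Q2 Q3.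
Qed.

End Ellipsoid.

Theorem theorem6p6 (R : realType) (N1 N2 : nat) (a b c f3 h3 g10 g20 : R)
    (g1p g1m g2 : int -> R) :
  (0 < N1)%N -> (0 < N2)%N ->
  c < b -> b < a -> 0 < c ->
  (a - 2 * b + c) / (a - c) =
    cos ((4 * N2%:R - 1) * pi / (4 * N1%:R + 4 * N2%:R - 2)) /
    cos (pi / (4 * N1%:R + 4 * N2%:R - 2)) ->
  0 < f3 -> 0 < h3 ->
  (b - c) * f3 ^+ 2 + (a - b) * h3 ^+ 2 = a - c ->
  g10 != 0 -> g20 != 0 ->
  g1_solution N1 N2 a b c g10 g1p ->
  g1_solution N1 N2 a b c (- g10) g1m ->
  g2_solution N1 N2 a b c g20 g2 ->
  let X := ellipsoid N1 N2 a b c f3 h3 g1p g1m g2 in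
  (* (i) *)
  (degenerations N1 N2 =i
     [seq [:: u] | u <- umbilic_vertices N1 N2] ++ umbilic_edges N1 N2) /\
  (forall (star : bool) (eps : int) (C : seq idx),
     eps \in signs -> C \in cross_sections N1 N2 star eps ->
     (* C collapses to a vertex (primal) or to an edge (dual) *)
     (C \in ends (cross_sections N1 N2 star eps)) =
       (size (undup [seq X m | m <- C]) == if star then 2%N else 1%N)) /\
  (* (ii) *)
  (forall (star : bool) (eps s : int),
     eps \in signs ->
     let C := cross_section N1 N2 star eps s in
     C != [::] ->
     (forall m, m \in with_plane N1 N2 C -> \dim (box N1 N2 X m) = 3%N) /\
     exists P : 'rV[R]_4,
       [/\ P != 0,
           (* P is a finite point, except possibly on the central sections *)
           s != 0 -> P 0 0 != 0,
           exists2 t : int, t \in signs & P \in umbilic_line N1 N2 X 1 t,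
           forall m, m \in with_plane N1 N2 C -> P \in box N1 N2 X m
         & (* the planes have no other common point *)
           (2 < size (with_plane N1 N2 C))%N ->
           forall Q : 'rV[R]_4,
             (forall m, m \in with_plane N1 N2 C -> Q \in box N1 N2 X m) ->
             Q \in <[P]>%VS]).
Proof.
move=> N1_gt0 N2_gt0 lt_cb lt_ba _ closing f3_gt0 h3_gt0 _ _ _ g1pP g1mP g2P X.
split; first exact: degenerations_umbilic.
split=> [star eps C eps1 C_in|star eps s eps1 C C0].
  by apply: cross_section_collapse; eassumption.
by apply: section_planes; eassumption.
Qed.
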